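(* Let $l/\mathbb{Q}$ and $k/\mathbb{Q}$ be finite Galois extensions with $\mathbb{Q}\subseteq k\subseteq l$ and $1\le r(k)<r(l)$, and let $\eta_1,\dots,\eta_{r(l)}$ be a basis of the free abelian group $F_l$. (i) If $l/\mathbb{Q}$ is totally real, there exists a relative Minkowski unit $\gamma\in E_{l/k}$ with $$h(\gamma)\le 4\bigl([l:k]-1\bigr)\sum_{j=1}^{r(l)}h(\eta_j).$$ (ii) If $l/\mathbb{Q}$ is totally complex, there exists a relative Minkowski unit $\gamma\in E_{l/k}$ with $$h(\gamma)\le 8\bigl([l:k]-1\bigr)\sum_{j=1}^{r(l)}h(\eta_j).$$
   Context: For a number field $l$, $O_l^\times$ is the unit group of its ring of integers, $\mathrm{Tor}(O_l^\times)$ the group of roots of unity, and $F_l=O_l^\times/\mathrm{Tor}(O_l^\times)$, a free abelian group of rank $r(l)$ (the unit rank); elements are written via coset representatives. For each place $w$ of $l$, $\|\cdot\|_w$ extends the usual absolute value of $\mathbb{Q}$ and $|\cdot|_w=\|\cdot\|_w^{d_w/d}$ with $d_w=[l_w:\mathbb{Q}_w]$, $d=[l:\mathbb{Q}]$. The Weil height is $h(\alpha)=\sum_w\log^+|\alpha|_w$, well defined on $F_l$. For $k\subseteq l$, the norm $\mathrm{Norm}_{l/k}$ induces a homomorphism $\mathrm{norm}_{l/k}:F_l\to F_k$, and the group of relative units is $E_{l/k}=\ker(\mathrm{norm}_{l/k})$, a subgroup of rank $r(l/k)=r(l)-r(k)$. When $l/\mathbb{Q}$ and $k/\mathbb{Q}$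 are both Galois, $\mathrm{Aut}(l/\mathbb{Q})$ maps $E_{l/k}$ into itself, and $\gamma\in E_{l/k}$ is called a relative Minkowski unit if the subgroup generated by $\{\sigma(\gamma):\sigma\in\mathrm{Aut}(l/\mathbb{Q})\}$ has rank $r(l/k)$. *)

(* Defs.v *)
From HB Require Import structures.
From mathcomp Require Import all_boot all_order all_algebra all_fingroup all_field.
Set Implicit Arguments. Unset Strict Implicit. Unset Printing Implicit Defensive.
Import Order.TTheory GRing.Theory Num.Theory.
Local Open Scope ring_scope.

(* A number field Galois over Q is modelled as L : splittingFieldType rat
   (a finite normal, hence Galois since char 0, extension of Q).
   Aut(l/Q) = 'Gal({:L} / 1). Subfields k are K : {subfield L}. *)

Section NF.
Variable L : splittingFieldType rat.

Definition integral (x : L) : Prop :=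
  exists2 p : {poly int}, p \is monic & root (map_poly (fun z : int => z%:~R) p) x.

Definition is_unit_int (x : L) : Prop :=
  x != 0 /\ integral x /\ integral x^-1.

Definition unit_of (K : {subfield L}) (x : L) : Prop :=
  x \in K /\ is_unit_int x.

Definition root_of_unity (x : L) : Prop :=
  exists2 n : nat, (0 < n)%N & x ^+ n = 1.

(* u_1..u_n are multiplicatively independent modulo torsion, i.e. their
   classes in F = units / torsion are Z-linearly independent *)
Definition mult_indep n (u : 'I_n -> L) : Prop :=
  forall e : 'I_n -> int,
    root_of_unity (\prod_(i < n) u i ^ e i) -> forall i, e i = 0.

(* The (image in F of the) subgroup A has rank r: it contains r independent
   classes and no r+1 independent classes. A is given by a predicate of
   representatives (closed under torsion). *)
Definition has_rank (A : L -> Prop) (r : nat) : Prop :=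
  (exists u : 'I_r -> L, (forall i, A (u i)) /\ mult_indep u) /\
  ~ (exists u : 'I_r.+1 -> L, (forall i, A (u i)) /\ mult_indep u).

Definition unit_rank (K : {subfield L}) (r : nat) : Prop :=
  has_rank (unit_of K) r.

Definition is_basis_F n (eta : 'I_n -> L) : Prop :=
  (forall j, is_unit_int (eta j)) /\ mult_indep eta /\
  forall x, is_unit_int x ->
    exists e : 'I_n -> int, root_of_unity (x / \prod_(j < n) eta j ^ e j).

Definition rel_unit (K : {subfield L}) (g : L) : Prop :=
  is_unit_int g /\ root_of_unity (galNorm K fullv g).

(* the subgroup of F_l generated by the Galois conjugates of g
   (representatives: products of conjugates times roots of unity) *)
Definition conj_subgroup (g : L) (x : L) : Prop :=
  exists e : gal_of fullv -> int,
    root_of_unity (x / \prod_(s in 'Gal(fullv / 1%AS)%g) (s g) ^ e s).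

Definition rel_minkowski (K : {subfield L}) (rlk : nat) (g : L) : Prop :=
  rel_unit K g /\ has_rank (conj_subgroup g) rlk.

(* Embeddings of l into C: since l/Q is Galois, they are exactly
   iota \o s for s in Aut(l/Q), for any fixed embedding iota. *)
Definition totally_real (iota : {rmorphism L -> algC}) : Prop :=
  forall x : L, forall s, s \in 'Gal(fullv / 1%AS)%g -> iota (s x) \is Num.real.

Definition totally_complex (iota : {rmorphism L -> algC}) : Prop :=
  forall s, s \in 'Gal(fullv / 1%AS)%g -> exists x : L, iota (s x) \isn't Num.real.

(* For a unit x, the finite places contribute log^+ 1 = 0, so
   d * h(x) = sum over embeddings tau of log max(1, |tau x|).
   Hd x = exp(d * h(x)) = prod_tau max(1, |tau x|)  (d = [l:Q]). *)
Definition Hd (iota : {rmorphism L -> algC}) (x : L) : algC :=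
  \prod_(s in 'Gal(fullv / 1%AS)%g) Num.max 1 `|iota (s x)|.

End NF.

(* Main.v *)
From Pilot Require Import Defs.
From HB Require Import structures.
From mathcomp Require Import classical_sets boolp reals Rstruct.
From mathcomp Require Import all_boot all_order all_algebra all_fingroup all_field.
From mathcomp Require Import zify ring lra.
Set Implicit Arguments. Unset Strict Implicit. Unset Printing Implicit Defensive.
Import Pilot.Defs.
Import Order.TTheory GRing.Theory Num.Theory.
Local Open Scope ring_scope.

(* Let G = Gal(l/Q), n = [l:k], let c in G induce complex conjugation and
   D = {1, c}. Attach to a unit x the function s |-> log |iota (s x)| on G. By
   Dirichlet's argument (a unit with a single place of absolute value above 1)
   the logarithms of the basis eta_j span over R all functions with sum 0 that
   are invariant under right translation by c. The relative units
   zeta_j = eta_j^n / Norm(eta_j) satisfy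
   sum_j h(zeta_j) <= 2(n-1) sum_j h(eta_j), and their logarithms span a space
   W that contains p = 1_D - (average of 1_D over the cosets of Gal(l/k));
   convolution by p is multiplication by |D| on W. Rounding the coefficients of
   a large multiple t p on the zeta_j to integers gives a unit gamma whose
   logarithm differs from t p by at most S = sum_j |G| h(zeta_j) in l^1 norm; for
   t |D| = 3S/2 convolution by log gamma is still injective on W, so that the
   conjugates of gamma generate a group of the same rank as the zeta_j, and
   |log gamma|_1 <= 4S. This gives the constant 4 in both cases. *)

(** * Binary logarithms of positive algebraic numbers *)

Section Log2.
Variable R : realType.
Implicit Types (x y : algC) (p : int) (q : nat).

Lemma exprz2_gt0 p : (0 : algC) < 2 ^ p.
Proof. by rewrite exprz_gt0 // ltr0n. Qed.

Lemma exprz2_mono : {mono (fun p => (2 : algC) ^ p) : p p' / p <= p'}.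
Proof.
apply: le_mono => p p' lt_pp'.
have -> : p' = p + `|p' - p|%N%:Z by lia.
rewrite expfzDr ?pnatr_eq0 // ltr_pMr ?exprz2_gt0 // -exprnP exprn_egt1 ?ltr1n //.
lia.
Qed.

Lemma exprz2_floor x : 0 < x -> exists p, (2 : algC) ^ p <= x < 2 ^ (p + 1).
Proof.
have ge1 y : 1 <= y -> exists p, (2 : algC) ^ p <= y < 2 ^ (p + 1).
  move=> y1.
  have ex : exists n : nat, y < 2 ^+ n.
    exists (Num.bound y); have y0 : 0 <= y by apply: le_trans y1.
    apply: lt_trans (archi_boundP y0) _.
    by rewrite -natrX ltr_nat ltn_expl.
  case: (ex_minnP ex) => [[|n]] yn nmin.
    by have := le_lt_trans y1 yn; rewrite expr0 ltxx.
  exists n%:Z; rewrite addrC -intS -!exprnP yn andbT.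
  rewrite real_leNgt ?rpredX ?ger0_real ?(le_trans _ y1) // ?ler0n //.
  by apply/negP => /nmin; rewrite ltnn.
move=> x0; have [k xk] : exists k : nat, 1 <= x * 2 ^+ k.
  exists (Num.bound x^-1).
  rewrite -ler_pdivrMl // mulr1.
  have /archi_boundP/ltW : 0 <= x^-1 by rewrite invr_ge0 ltW.
  move/le_trans; apply.
  by rewrite -natrX ler_nat ltnW // ltn_expl.
have [p /andP[p1 p2]] := ge1 _ xk.
exists (p - k%:Z).
have k0 : (0 : algC) < 2 ^+ k by rewrite exprn_gt0 // ltr0n.
rewrite addrAC [2 ^ (p - _)]expfzDr ?[2 ^ (p + 1 - _)]expfzDr ?pnatr_eq0 // -exprnN.
by rewrite ler_pdivrMr // ltr_pdivlMr // p1 p2.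
Qed.

(** A cut of the binary logarithm by rationals: [2 ^ p <= x ^+ q.+1] says that [p / q.+1] is at most
    log x, so only integer powers of algebraic numbers are compared. *)
Definition log2_cut x : set R :=
  [set r | exists p, exists q, r = p%:~R / q.+1%:R /\ 2 ^ p <= x ^+ q.+1].

Definition log2 x : R := sup (log2_cut x).

Lemma exprz2X p q : ((2 : algC) ^ p) ^+ q = 2 ^ (p * q%:Z).
Proof. by rewrite exprnP exprz_exp. Qed.

Lemma log2_cut_ub x p q : 0 < x -> x ^+ q.+1 <= 2 ^ p ->
  ubound (log2_cut x) (p%:~R / q.+1%:R).
Proof.
move=> x0 xp _ [p' [q' [-> xp']]].
rewrite ler_pdivrMr ?ltr0Sn // mulrAC ler_pdivlMr ?ltr0Sn //.
rewrite !pmulrn -!intrM ler_int -exprz2_mono -!exprz2X.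
have le1 : (2 ^ p') ^+ q.+1 <= (x ^+ q'.+1) ^+ q.+1.
  by rewrite lerXn2r // nnegrE ?exprn_ge0 ?ltW ?exprz2_gt0.
apply: le_trans le1 _; rewrite -exprM mulnC exprM.
by rewrite lerXn2r // nnegrE ?exprn_ge0 ?ltW ?exprz2_gt0.
Qed.

Lemma has_sup_log2_cut x : 0 < x -> has_sup (log2_cut x).
Proof.
move=> x0; have [p /andP[p1 p2]] := exprz2_floor x0; split.
  by exists (p%:~R / 1%:R), p, 0%N.
by exists ((p + 1)%:~R / 1%:R); apply: log2_cut_ub => //; rewrite expr1 ltW.
Qed.

Lemma log2_ge x p q : 0 < x -> 2 ^ p <= x ^+ q.+1 -> p%:~R / q.+1%:R <= log2 x.
Proof.
by move=> x0 px; apply: sup_upper_bound; [exact: has_sup_log2_cut | exists p, q].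
Qed.

Lemma log2_le x p q : 0 < x -> x ^+ q.+1 <= 2 ^ p -> log2 x <= p%:~R / q.+1%:R.
Proof.
by move=> x0 px; apply: ge_sup; [case: (has_sup_log2_cut x0) | exact: log2_cut_ub].
Qed.

(** Rounding [x ^+ q.+1] and [y ^+ q.+1] down to powers of 2 locates each logarithm within
    [1 / q.+1] and that of the product within [2 / q.+1], for [q] as large as wanted. *)
Lemma log2M x y : 0 < x -> 0 < y -> log2 (x * y) = log2 x + log2 y.
Proof.
move=> x0 y0; have xy0 : 0 < x * y by rewrite mulr_gt0.
apply/eqP; rewrite -subr_eq0 -normr_le0; apply/ler_addgt0Pl => e e0.
rewrite addr0; pose q := Num.bound (2 / e).
have [px /andP[px1 px2]] := exprz2_floor (exprn_gt0 q.+1 x0).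
have [py /andP[py1 py2]] := exprz2_floor (exprn_gt0 q.+1 y0).
have := log2_ge x0 px1; have := log2_le x0 (ltW px2).
have := log2_ge y0 py1; have := log2_le y0 (ltW py2).
have : (px + py)%:~R / q.+1%:R <= log2 (x * y).
  apply: log2_ge => //; rewrite expfzDr ?pnatr_eq0 // exprMn.
  by rewrite ler_pM // ltW // exprz2_gt0.
have : log2 (x * y) <= ((px + 1) + (py + 1))%:~R / q.+1%:R.
  apply: log2_le => //; rewrite [X in _ <= X]expfzDr ?pnatr_eq0 // exprMn.
  by rewrite ler_pM // ?exprn_ge0 // ltW // exprz2_gt0.
have le2 : 2 / q.+1%:R <= e.
  have b0 : 2 / e < q%:R by apply: archi_boundP; rewrite divr_ge0 // ltW.
  rewrite ler_pdivrMr ?ltr0Sn // mulrC -ler_pdivrMr //.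
  by rewrite (le_trans (ltW b0)) // ler_nat.
move: le2; rewrite !rmorphD /= !rmorph1 !mulrDl !mul1r.
set a := _ / q.+1%:R; set b := _ / q.+1%:R; set i := q.+1%:R^-1; move=> le2 h1 h2 h3 h4 h5 h6.
by rewrite ler_norml; apply/andP; split; lra.
Qed.

(** By Bernoulli, [x ^+ q.+1] reaches 2 once [q.+1] exceeds [(x - 1)^-1], which puts [1 / q.+1] into
    the cut. *)
Lemma log2_gt0 x : 1 < x -> 0 < log2 x.
Proof.
move=> x1; have x0 : 0 < x by apply: lt_trans x1.
pose q := Num.bound (x - 1)^-1; have d0 : 0 < x - 1 by rewrite subr_gt0.
have b0 : (x - 1)^-1 < q%:R by apply: archi_boundP; rewrite invr_ge0 ltW.
have bern n : 1 + n%:R * (x - 1) <= x ^+ n.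
  elim: n => [|n IHn]; first by rewrite mul0r addr0.
  rewrite exprS; apply: le_trans (ler_wpM2l (ltW x0) IHn).
  rewrite -subr_ge0 -natr1.
  rewrite (_ : _ - _ = n%:R * (x - 1) ^+ 2); last by ring.
  by rewrite mulr_ge0 // exprn_ge0 // ltW.
apply: lt_le_trans (_ : 1%:~R / q.+1%:R <= _); first by rewrite divr_gt0 ?ltr0Sn.
apply: log2_ge => //; rewrite expr1z; apply: le_trans (bern _).
rewrite -[X in X <= _]/(1 + 1) lerD2l -ler_pdivrMr // div1r.
by rewrite (le_trans (ltW b0)) // ler_nat.
Qed.

Lemma log2_1 : log2 1 = 0.
Proof. by apply: (addrI (log2 1)); rewrite -log2M ?mulr1 // addr0. Qed.

Lemma log2V x : 0 < x -> log2 x^-1 = - log2 x.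
Proof.
move=> x0; apply: (addrI (log2 x)); rewrite -log2M ?invr_gt0 //.
by rewrite divff ?gt_eqF // log2_1 subrr.
Qed.

Lemma log2_mono : {in Num.pos &, {mono log2 : x y / x <= y}}.
Proof.
have lt_log2 x y : 0 < x -> 0 < y -> x < y -> log2 x < log2 y.
  move=> x0 y0 xy; rewrite -subr_gt0 -log2V // -log2M ?invr_gt0 //.
  by apply: log2_gt0; rewrite ltr_pdivlMr // mul1r.
move=> x y; rewrite !posrE => x0 y0.
have [|/lt_log2 yx] := real_leP (gtr0_real x0) (gtr0_real y0); last first.
  by rewrite leNgt yx.
by rewrite le_eqVlt => /orP[/eqP->|/(lt_log2 _ _ x0 y0)/ltW->//]; rewrite lexx.
Qed.

Lemma log2_lt0 x : 0 < x -> x < 1 -> log2 x < 0.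
Proof.
by move=> x0 x1; rewrite -oppr_gt0 -log2V // log2_gt0 // invf_gt1.
Qed.

Lemma log2_prod (I : Type) (r : seq I) (P : pred I) (F : I -> algC) :
  (forall i, P i -> 0 < F i) ->
  log2 (\prod_(i <- r | P i) F i) = \sum_(i <- r | P i) log2 (F i).
Proof.
move=> F0; suff [] : 0 < \prod_(i <- r | P i) F i /\
  log2 (\prod_(i <- r | P i) F i) = \sum_(i <- r | P i) log2 (F i) by [].
elim/big_rec2: _ => [|i y1 y2 Pi [y20 <-]]; first by rewrite log2_1.
by rewrite mulr_gt0 ?F0 // log2M // F0.
Qed.

Lemma log2Xz x (m : int) : 0 < x -> log2 (x ^ m) = m%:~R * log2 x.
Proof.
move=> x0; have nat_case (n : nat) : log2 (x ^+ n) = n%:R * log2 x.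
  elim: n => [|n IHn]; first by rewrite expr0 log2_1 mul0r.
  by rewrite exprS log2M ?exprn_gt0 // IHn -nat1r mulrDl mul1r.
case: m => n; first by rewrite -exprnP nat_case.
by rewrite NegzE -exprnN log2V ?exprn_gt0 // nat_case mulrNz mulNr.
Qed.

Lemma log2_max1 x : 0 < x -> log2 (Num.max 1 x) = Num.max 0 (log2 x).
Proof.
move=> x0; have [x1|x1] := real_leP (ger0_real ler01) (gtr0_real x0).
  have := log2_mono (x := 1) (y := x); rewrite !posrE x0 ltr01 log2_1 x1.
  by move=> /(_ isT isT)/max_r.
by rewrite log2_1 max_l // ltW // log2_lt0.
Qed.

End Log2.

(** * A vector whose translates span the relative space *)

Section RelativeMinkowskiVector.
Variables (R : archiRealFieldType) (gT : finGroupType) (H : {group gT}) (c : gT).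
Hypotheses (nH : (H <| [set: gT])%g) (cc : (c * c = 1)%g).

(** The choice [c = 1] is allowed and makes [#|D|] equal to 1: this is the totally real case. *)
Let D : {set gT} := [set 1%g; c].
Let ind (s : gT) : R := (s \in D)%:R.
Let av s : R := \sum_(h in H) ind (h * s)%g.
Let p s : R := ind s - av s / #|H|%:R.

Let cV : (c^-1 = c)%g. Proof. by apply/eqP; rewrite eq_invg_mul cc. Qed.

Let n0 : (0 : R) < #|H|%:R. Proof. by rewrite ltr0n cardG_gt0. Qed.

Let D0 : (0 : R) < #|D|%:R.
Proof. by rewrite ltr0n; apply/card_gt0P; exists 1%g; rewrite !inE eqxx. Qed.

Let ind_c s : ind (s * c)%g = ind s.
Proof.
rewrite /ind !inE orbC; congr ((_ || _)%:R).
  by rewrite -(inj_eq (mulIg c^-1)%g) mulgK mulgV.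
by rewrite -(inj_eq (mulIg c^-1)%g) mulgK mul1g cV.
Qed.

Let sum_ind : \sum_s ind s = #|D|%:R.
Proof.
rewrite -sumr_const [RHS]big_mkcond; apply: eq_bigr => s _.
by rewrite /ind; case: (_ \in _).
Qed.

Lemma sum_coset_sum (f : gT -> R) :
  \sum_s \sum_(h in H) f (h * s)%g = #|H|%:R * \sum_s f s.
Proof.
rewrite exchange_big /= mulr_natl -sumr_const; apply: eq_bigr => h _.
by rewrite [RHS](reindex_inj (mulgI h)).
Qed.

Lemma coset_sum_coset_sum (f : gT -> R) s :
  \sum_(h in H) \sum_(k in H) f (k * (h * s))%g = #|H|%:R * \sum_(h in H) f (h * s)%g.
Proof.
rewrite mulr_natl -sumr_const; apply: eq_bigr => h hH.
rewrite [RHS](reindex_inj (mulIg h)) /=.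
by apply: eq_big => [k|k _]; rewrite ?groupMr // mulgA.
Qed.

Lemma sum_lcoset_rcoset (f : gT -> R) s :
  \sum_(h in H) f (s * h)%g = \sum_(h in H) f (h * s)%g.
Proof.
rewrite (reindex_inj (conjg_inj s)) /=; apply: eq_big => [h|h _].
  by rewrite memJ_norm // (subsetP (normal_norm nH)) ?inE.
by rewrite conjgE mulKVg.
Qed.

Let p_c s : p (s * c)%g = p s.
Proof.
rewrite /p ind_c; congr (_ - _ / _); apply: eq_bigr => h _.
by rewrite mulgA ind_c.
Qed.

Let sum_p : \sum_s p s = 0.
Proof.
rewrite sumrB -mulr_suml sum_coset_sum mulrAC divff ?gt_eqF //.
by rewrite mul1r subrr.
Qed.

Let coset_sum_p s : \sum_(h in H) p (h * s)%g = 0.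
Proof.
rewrite sumrB -mulr_suml coset_sum_coset_sum mulrAC divff ?gt_eqF //.
by rewrite mul1r subrr.
Qed.

Let norm_p : \sum_s `|p s| <= 2 * #|D|%:R.
Proof.
have ind0 s : 0 <= ind s by rewrite ler0n.
have av0 s : 0 <= av s by apply: sumr_ge0.
apply: (@le_trans _ _ (\sum_s (ind s + av s / #|H|%:R))).
  apply: ler_sum => s _; apply: le_trans (ler_normB _ _) _.
  by rewrite !ger0_norm // divr_ge0 // ltW.
rewrite big_split /= -mulr_suml sum_coset_sum mulrAC divff ?gt_eqF //.
by rewrite mul1r sum_ind mulrDl mul1r.
Qed.

(** The averaged part of [p] contributes sums of [w] over cosets of [H], which vanish; the indicator
    part sums [w] over [s] times [D], where [w] is constant. *)
Let conv_p (w : gT -> R) s : (forall s, w (s * c)%g = w s) ->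
  (forall s, \sum_(h in H) w (s * h)%g = 0) ->
  \sum_t w t * p (t^-1 * s)%g = #|D|%:R * w s.
Proof.
move=> wc wH; under eq_bigr => t _ do rewrite mulrBr mulrA.
rewrite sumrB -mulr_suml.
have -> : \sum_t w t * av (t^-1 * s)%g = 0.
  under eq_bigr => t _ do rewrite mulr_sumr.
  rewrite exchange_big /=.
  transitivity (\sum_u \sum_(h in H) w (s * u^-1 * h)%g * ind u); last first.
    by rewrite big1 // => u _; rewrite -mulr_suml wH mul0r.
  rewrite [RHS]exchange_big; apply: eq_bigr => h hH.
  rewrite (reindex_inj (inj_comp (mulIg h) (inj_comp (mulgI s) invg_inj))) /=.
  by apply: eq_bigr => u _; rewrite !invMg !invgK !mulgA mulgV mul1g mulgKV.
rewrite mul0r subr0 (reindex_inj (inj_comp (mulgI s) invg_inj)) /=.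
rewrite -sum_ind mulr_suml; apply: eq_bigr => u _.
rewrite invMg invgK -mulgA mulVg mulg1 mulrC /ind !inE.
case: eqP => [->|_]; first by rewrite invg1 mulg1.
by case: eqP => [->|_]; rewrite ?mul0r // cV wc.
Qed.

(** A large multiple of [p] is rounded to an integer combination of the [z j]. The second
    conclusion, injectivity of convolution on the span of the [z j], is what gives the conjugates of
    the resulting unit full rank. *)
Lemma exists_relative_minkowski_vector r (a z : 'I_r -> gT -> R) :
    (forall j s, a j (s * c)%g = a j s) ->
    (forall j s, z j s = #|H|%:R * a j s - \sum_(h in H) a j (h * s)%g) ->
    (forall f : gT -> R, (forall s, f (s * c)%g = f s) -> \sum_s f s = 0 ->
       exists b : 'I_r -> R, forall s, f s = \sum_j b j * a j s) ->
  exists m : 'I_r -> int,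
    \sum_s `|\sum_j (m j)%:~R * z j s| <= 2 * \sum_j \sum_s `|z j s| /\
    forall b : 'I_r -> R,
      (forall s, \sum_t (\sum_j b j * z j t) *
                   (\sum_j (m j)%:~R * z j (t^-1 * s)%g) = 0) ->
      forall s, \sum_j b j * z j s = 0.
Proof.
move=> ac zE spanP; have [b0 b0E] := spanP p p_c sum_p.
set Z := \sum_j \sum_s `|z j s|.
have Z0 : 0 <= Z by rewrite !sumr_ge0 // => j _; rewrite sumr_ge0.
(* Injectivity needs [t * #|D|] above the rounding error [Z / 2]; with [3 / 4 * Z] the norm bound
   [t * (2 * #|D|) + Z / 2] comes out as [2 * Z]. *)
pose t := 3 / 4 * Z / #|D|%:R.
have t0 : 0 <= t by rewrite divr_ge0 ?(ltW D0) // mulr_ge0 // divr_ge0.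
(* The coset sums of [p] vanish, so the map taking [a j] to [z j] multiplies [p] by [#|H|]; it turns
   the expansion of [p] in the [a j] into one in the [z j]. *)
have pE s : p s = \sum_j b0 j / #|H|%:R * z j s.
  have n_neq0 : #|H|%:R != 0 :> R by rewrite gt_eqF.
  apply: (mulfI n_neq0); rewrite mulr_sumr.
  transitivity (#|H|%:R * p s - \sum_(h in H) p (h * s)%g).
    by rewrite coset_sum_p subr0.
  rewrite b0E mulr_sumr (eq_bigr _ (fun h _ => b0E _)) exchange_big -sumrB /=.
  apply: eq_bigr => j _; rewrite zE -mulr_sumr.
  by field; rewrite gt_eqF.
pose y j := t * (b0 j / #|H|%:R).
(* Nearest integer to [y j], off by at most 1/2. *)
pose m j := Num.floor (y j + 2^-1).
pose err s := \sum_j ((m j)%:~R - y j) * z j s.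
have gE s : \sum_j (m j)%:~R * z j s = t * p s + err s.
  rewrite pE mulr_sumr -big_split /=; apply: eq_bigr => j _.
  by rewrite /y; ring.
have norm_err : \sum_s `|err s| <= Z / 2.
  rewrite /Z exchange_big mulr_suml; apply: ler_sum => s _.
  rewrite mulr_suml; apply: le_trans (ler_norm_sum _ _ _) _.
  apply: ler_sum => j _; rewrite normrM mulrC ler_wpM2l //.
  have := floor_itv (y j + 2^-1); rewrite -/(m j) rmorphD rmorph1 => /andP[m1 m2].
  by rewrite ler_norml; apply/andP; split; lra.
have norm_conv (w e : gT -> R) :
    \sum_s `|\sum_t w t * e (t^-1 * s)%g| <= (\sum_s `|w s|) * \sum_s `|e s|.
  apply: (@le_trans _ _ (\sum_s \sum_t `|w t| * `|e (t^-1 * s)%g|)).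
    apply: ler_sum => s _; apply: le_trans (ler_norm_sum _ _ _) _.
    by apply: ler_sum => u _; rewrite normrM.
  rewrite exchange_big /= mulr_suml; apply: ler_sum => u _.
  by rewrite -mulr_sumr [X in _ <= _ * X](reindex_inj (mulgI u^-1)%g).
exists m; split.
  apply: (@le_trans _ _ (\sum_s (t * `|p s| + `|err s|))).
    apply: ler_sum => s _; rewrite gE; apply: le_trans (ler_normD _ _) _.
    by rewrite normrM (ger0_norm t0).
  rewrite big_split -mulr_sumr /=.
  have := ler_wpM2l t0 norm_p.
  have -> : t * (2 * #|D|%:R) = 3 / 2 * Z.
    by rewrite /t; field; rewrite gt_eqF.
  by move: norm_err; lra.
move=> b; set w := fun t => \sum_j b j * z j t => conv0.
have zc j s : z j (s * c)%g = z j s.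
  by rewrite !zE ac; congr (_ - _); apply: eq_bigr => h _; rewrite mulgA ac.
have zH j s : \sum_(h in H) z j (s * h)%g = 0.
  rewrite sum_lcoset_rcoset.
  under eq_bigr => h _ do rewrite zE.
  by rewrite sumrB coset_sum_coset_sum -mulr_sumr subrr.
have wc s : w (s * c)%g = w s by apply: eq_bigr => j _; rewrite zc.
have wH s : \sum_(h in H) w (s * h)%g = 0.
  by rewrite exchange_big big1 // => j _; rewrite -mulr_sumr zH mulr0.
have key s : 3 / 4 * Z * w s = - \sum_t w t * err (t^-1 * s)%g.
  apply/eqP; rewrite -addr_eq0 -[X in _ == X](conv0 s).
  under [X in _ == X]eq_bigr => u _ do rewrite gE mulrDr mulrCA.
  rewrite big_split /= -mulr_sumr conv_p //; apply/eqP; congr (_ + _).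
  by rewrite /t mulrA divfK // gt_eqF.
have Z34 : 0 <= 3 / 4 * Z by lra.
have := norm_conv w err.
have -> : \sum_s `|\sum_t w t * err (t^-1 * s)%g| = 3 / 4 * Z * \sum_s `|w s|.
  rewrite mulr_sumr; apply: eq_bigr => s' _.
  by rewrite -normrN -key normrM ger0_norm.
set W := \sum_s `|w s| => leW.
have W0 : 0 <= W by rewrite sumr_ge0.
(* The bounds give [3 / 4 * Z * W <= W * (Z / 2)], so [Z] or [W] vanishes; [Z = 0] is the degenerate
   case where all [z j] are zero. *)
have ZW : Z * W <= 0.
  have := ler_wpM2l W0 norm_err; nra.
have sum0 (I : finType) (F : I -> R) : \sum_i `|F i| = 0 -> forall i, F i = 0.
  move=> /psumr_eq0P F0 i; apply/eqP; rewrite -normr_eq0; apply/eqP.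
  exact: F0.
move: (mulr_ge0 Z0 W0) => ZW0.
have /eqP : Z * W = 0 by apply/eqP; rewrite eq_le ZW ZW0.
rewrite mulf_eq0 => /orP[/eqP Z00 | /eqP/sum0//] s.
rewrite /w big1 // => j _; rewrite [z j s](_ : _ = 0) ?mulr0 //.
apply: (sum0 _ (z j)).
by move/psumr_eq0P: Z00 => -> // k _; rewrite sumr_ge0.
Qed.
End RelativeMinkowskiVector.

(** * Integral elements and units of a Galois number field *)

Lemma pigeonhole (T T' : finType) (f : T -> T') :
  (#|T'| < #|T|)%N -> exists x y, x != y /\ f x = f y.
Proof.
move=> lt_card; have /injectivePn[x [y xy fxy]] : ~~ injectiveb f; last by exists x, y.
by apply/injectiveP => /leq_card; rewrite leqNgt lt_card.
Qed.

Lemma pigeonhole_nat (T : finType) (f : nat -> T) :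
  exists i j, (i < j)%N /\ f i = f j.
Proof.
have [|i [j [ij fij]]] := pigeonhole (fun i : 'I_#|T|.+1 => f i).
  by rewrite card_ord.
move: ij; rewrite -val_eqE neq_ltn => /orP[] ij; first by exists i, j.
by exists j, i; split.
Qed.

Section NumberField.
Variable L : splittingFieldType rat.
Local Notation gT := (gal_of (fullv : {vspace L})).
Implicit Types (x y : L) (s t : gT).

Lemma gal_full s : s \in 'Gal({:L} / 1%AS)%g.
Proof. by rewrite gal_kHom ?sub1v // k1AHom. Qed.

Lemma Gal_full : 'Gal({:L} / 1%AS)%g = [set: gT].
Proof. by apply/setP => s; rewrite gal_full inE. Qed.

Lemma galMfull s t x : (s * t)%g x = t (s x).
Proof. by rewrite galM ?memvf. Qed.

Lemma galois_full : galois 1%AS {:L}%AS.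
Proof.
rewrite /galois sub1v normalFieldf andbT /=.
apply/separableP => x _; apply: pcharf0_separable.
exact: ftrans (pchar_lalg L) (pchar_num _).
Qed.

Lemma card_gal_full : #|{: gT}| = \dim {:L}.
Proof.
have := galois_dim galois_full; rewrite Gal_full cardsT => <-.
by rewrite dimv1 divn1.
Qed.


Lemma intrL_inj : injective (fun m : int => m%:~R : L).
Proof.
move=> m n /= mn; apply: (@intr_inj rat); apply: (fmorph_inj (in_alg L)).
by rewrite !rmorph_int.
Qed.

Lemma intrL_eq0 (m : int) : (m%:~R == 0 :> L) = (m == 0).
Proof. exact: (inj_eq intrL_inj m 0). Qed.

Lemma integral_gal s x : integral x -> integral (s x).
Proof.
case=> p p_mon px; exists p => //.
rewrite -(fmorph_root s) -map_poly_comp in px.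
by rewrite (eq_map_poly (g := fun z : int => z%:~R)) // in px => z /=; rewrite rmorph_int.
Qed.

Lemma integralM x y : integral x -> integral y -> integral (x * y).
Proof. exact: (@integral_mul int L intr). Qed.

Lemma integralD x y : integral x -> integral y -> integral (x + y).
Proof. exact: (@integral_add int L intr). Qed.

Lemma integral_intr (m : int) : integral (m%:~R : L).
Proof. exact: (@integral_id int L intr). Qed.

Lemma integral1 : integral (1 : L).
Proof. exact: (@integral1 int L intr). Qed.

Lemma integral_sum (I : Type) (r : seq I) (P : pred I) (F : I -> L) :
  (forall i, P i -> integral (F i)) -> integral (\sum_(i <- r | P i) F i).
Proof.
by move=> F_int; elim/big_ind: _ => //; [exact: (integral_intr 0) | exact: integralD].
Qed.

Lemma integral_prod (I : Type) (r : seq I) (P : pred I) (F : I -> L) :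
  (forall i, P i -> integral (F i)) -> integral (\prod_(i <- r | P i) F i).
Proof.
by move=> F_int; elim/big_ind: _ => //; [exact: integral1 | exact: integralM].
Qed.

Lemma is_unit_intM x y : is_unit_int x -> is_unit_int y -> is_unit_int (x * y).
Proof.
move=> [x0 [xi xVi]] [y0 [yi yVi]].
by split; [rewrite mulf_neq0 | rewrite invfM; split; exact: integralM].
Qed.

Lemma is_unit_int1 : is_unit_int (1 : L).
Proof. by split; [exact: oner_neq0 | rewrite invr1; split; exact: integral1]. Qed.

Lemma is_unit_intV x : is_unit_int x -> is_unit_int x^-1.
Proof. by move=> [x0 [xi xVi]]; split; rewrite ?invr_eq0 ?invrK. Qed.

Lemma is_unit_intX x n : is_unit_int x -> is_unit_int (x ^+ n).
Proof.
move=> xu; elim: n => [|n IHn]; first exact: is_unit_int1.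
by rewrite exprS; exact: is_unit_intM.
Qed.

Lemma is_unit_intXz x (m : int) : is_unit_int x -> is_unit_int (x ^ m).
Proof.
case: m => n xu; first exact: is_unit_intX.
by rewrite NegzE -exprnN; apply/is_unit_intV/is_unit_intX.
Qed.

Lemma is_unit_int_prod (I : Type) (r : seq I) (P : pred I) (F : I -> L) :
  (forall i, P i -> is_unit_int (F i)) -> is_unit_int (\prod_(i <- r | P i) F i).
Proof.
by move=> F_unit; elim/big_ind: _ => //; [exact: is_unit_int1 | exact: is_unit_intM].
Qed.

Lemma is_unit_int_gal s x : is_unit_int x -> is_unit_int (s x).
Proof.
move=> [x0 [xi xVi]]; split; first by rewrite fmorph_eq0.
by rewrite -fmorphV; split; apply: integral_gal.
Qed.

Lemma root_of_unity_is_unit x : root_of_unity x -> is_unit_int x.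
Proof.
have rint y : root_of_unity y -> integral y.
  case=> n n0 yn; exists ('X^n - 1); first exact: monicXnsubC.
  by rewrite rmorphB rmorph1 /= map_polyXn /root !hornerE yn subrr.
case=> n n0 xn; split; last first.
  by split; apply: rint; exists n; rewrite // exprVn xn invr1.
by apply: contra_eq_neq xn => ->; rewrite expr0n gtn_eqF // eq_sym oner_neq0.
Qed.

(** If an integer polynomial q of degree n + 1 with leading coefficient c vanishes at x, then c x is
    a root of c^n q(X / c), which is monic with integer coefficients; this is [r] below. *)
Lemma exists_integral_multiple x : exists2 m : int, m != 0 & integral (m%:~R * x).
Proof.
have /polyOver1P[p Dp] : minPoly 1%AS x \is a polyOver 1%AS by exact: minPolyOver.
have [q [a a0 p_eq]] := rat_poly_scale p.
pose qL := map_poly (fun z : int => z%:~R : L) q.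
have sz_qL : size qL = size q by rewrite size_map_inj_poly // ?mulr0z //; apply: intrL_inj.
have qx : qL.[x] = 0.
  have := root_minPoly 1%AS x; rewrite Dp p_eq /root map_polyZ hornerZ.
  rewrite mulf_eq0 fmorph_eq0 invr_eq0 intr_eq0 (negPf a0) /= => /eqP <-.
  rewrite -map_poly_comp /qL; congr _.[_]; apply: eq_map_poly => z.
  by rewrite -(rmorph_int (in_alg L)).
have q0 : q != 0.
  apply: contraTneq (monic_neq0 (monic_minPoly 1%AS x)) => q0.
  by rewrite Dp p_eq q0 !rmorph0 scaler0 rmorph0 eqxx.
have sz_q : (1 < size q)%N.
  rewrite ltnNge; apply/negP => /size1_polyC q_const.
  move: qx q0; rewrite /qL q_const map_polyC hornerC /= => /eqP.
  by rewrite intrL_eq0 polyC_eq0 => ->.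
case sz_qE : (size q) sz_q => [|[|n]] // _.
pose c := lead_coef q; exists c; first by rewrite lead_coef_eq0.
pose r := 'X^(n.+1) + \poly_(i < n.+1) (q`_i * c ^+ (n - i)).
exists r.
  by rewrite monicE lead_coefDl ?lead_coefXn // size_polyXn ltnS size_poly.
rewrite /root; apply/eqP; transitivity (c%:~R ^+ n * qL.[x]); last by rewrite qx mulr0.
rewrite rmorphD /= map_polyXn hornerD hornerXn (horner_coef_wide (n := n.+1)); last first.
  by exact: leq_trans (size_poly _ _) (size_poly _ _).
rewrite [in RHS](horner_coef_wide (n := n.+2)) ?sz_qL ?sz_qE //.
rewrite [in RHS]big_ord_recr /= [RHS]mulrDr addrC.
congr (_ + _).
  rewrite mulr_sumr; apply: eq_bigr => i _.
  rewrite !coef_map_id0 ?mulr0z // coef_poly ltn_ord rmorphM rmorphXn /= exprMn.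
  have -> : (c%:~R : L) ^+ n = c%:~R ^+ (n - i) * c%:~R ^+ i.
    by rewrite -exprD subnK // -ltnS ltn_ord.
  by ring.
rewrite exprMn exprS [RHS]mulrA; congr (_ * _).
rewrite coef_map_id0 ?mulr0z // mulrC; congr (_ * _).
by rewrite /c /lead_coef sz_qE.
Qed.

Section Embedding.
Variable iota : {rmorphism L -> algC}.

Lemma integral_Aint x : integral x -> iota x \in Aint.
Proof.
case=> p p_mon px; apply: (@root_monic_Aint (map_poly intr p)).
- rewrite -(fmorph_root iota) -map_poly_comp in px.
  by rewrite (eq_map_poly (g := intr)) // in px => z /=; rewrite rmorph_int.
- exact: monic_map.
by apply/polyOverP => i; rewrite coef_map /= intr_int.
Qed.

Lemma integral_ratint x : x \in 1%VS -> integral x -> exists m : int, x = m%:~R.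
Proof.
case/vlineP => q -> /integral_Aint qi.
have := Cint_rat_Aint _ qi; rewrite rmorphZ_num rmorph1 mulr1 => /(_ (Crat_rat q)).
case/intrP => m qm; exists m; apply: (fmorph_inj iota).
by rewrite rmorphZ_num rmorph1 mulr1 qm rmorph_int.
Qed.

(** [L] is normal over Q, so complex conjugation preserves the image of [iota] and pulls back to an
    automorphism, the identity exactly when [L] is totally real. *)
Lemma conj_gal : exists c : gT, (c * c = 1)%g /\ forall x, iota (c x) = (iota x)^*.
Proof.
have [nu nuE] := restrict_aut_to_normal_num_field iota (Num.conj : {rmorphism algC -> algC}).
have /kAut_to_gal[c _ cE] : kAut 1 {:L} (linfun nu).
  rewrite kAutfE; apply/kHom_monoid_morphism; split=> [|x y].
    by rewrite lfunE /= rmorph1.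
  by rewrite !lfunE /= rmorphM.
have cx x : iota (c x) = (iota x)^*.
  by rewrite -cE ?memvf // lfunE /= nuE.
exists c; split=> //; apply/eqP/gal_eqP => x _; rewrite galMfull gal_id.
by apply: (fmorph_inj iota); rewrite !cx conjCK.
Qed.

End Embedding.
End NumberField.

(** * Traces, norms and finiteness of integers with bounded conjugates *)

Section Northcott.
Variable L : splittingFieldType rat.
Variable iota : {rmorphism L -> algC}.
Local Notation gT := (gal_of (fullv : {vspace L})).
Implicit Types (x y : L) (s t : gT).

Lemma galTraceE x : galTrace 1%AS {:L} x = \sum_(s : gT) s x.
Proof. by rewrite /galTrace; apply: eq_bigl => s; rewrite gal_full. Qed.

Lemma galNormE x : galNorm 1%AS {:L} x = \prod_(s : gT) s x.
Proof. by rewrite /galNorm; apply: eq_bigl => s; rewrite gal_full. Qed.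

Lemma integral_galTrace x : integral x -> exists m : int, galTrace 1%AS {:L} x = m%:~R.
Proof.
move=> xi; apply: (integral_ratint iota).
  by apply: mem_galTrace (galois_full L) (memvf _).
by rewrite galTraceE; apply: integral_sum => s _; apply: integral_gal.
Qed.

Lemma integral_galNorm x : integral x -> exists m : int, galNorm 1%AS {:L} x = m%:~R.
Proof.
move=> xi; apply: (integral_ratint iota).
  by apply: mem_galNorm (galois_full L) (memvf _).
by rewrite galNormE; apply: integral_prod => s _; apply: integral_gal.
Qed.

(** A basis over Q of integral elements, not necessarily generating the ring of integers. The last
    clause is nondegeneracy of the trace form: a nonzero [x] orthogonal to the basis would give
    trace 0 to [x * x^-1], whose trace is the degree. *)
Lemma exists_integral_basis : exists b : 'I_(\dim {:L}) -> L,
  [/\ forall i, integral (b i),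
      forall a : 'I_(\dim {:L}) -> int, \sum_i (a i)%:~R * b i = 0 -> forall i, a i = 0
    & forall x, (forall i, galTrace 1%AS {:L} (x * b i) = 0) -> x = 0].
Proof.
have [m mP] := choice (fun x => let: ex_intro2 m m0 mi := exists_integral_multiple x in
  ex_intro (fun m : int => m != 0 /\ integral (m%:~R * x)) m (conj m0 mi)).
pose X := vbasis {:L}; exists (fun i => (m X`_i)%:~R * X`_i).
have mulrz_scale (k : int) x : k%:~R * x = (k%:~R : rat) *: x.
  by rewrite scaler_int mulrzl.
split=> [i | a a0 i | x x0].
- by have [] := mP X`_i.
- have /freeP/(_ (fun i => (a i * m X`_i)%:~R)) : free X by apply/basis_free/vbasisP.
  have -> : \sum_i (a i * m X`_i)%:~R *: X`_i = 0.
    by rewrite -[RHS]a0; apply: eq_bigr => j _; rewrite -mulrz_scale intrM mulrA.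
  move=> /(_ erefl i)/eqP; rewrite intr_eq0 mulf_eq0 => /orP[/eqP//|].
  by have [/negPf->] := mP X`_i.
apply: contraTeq isT => x_neq0.
have : galTrace 1%AS {:L} (x * x^-1) = 0.
  rewrite (coord_vbasis (memvf x^-1)) mulr_sumr galTraceE.
  under eq_bigr => s _ do rewrite rmorph_sum /=.
  rewrite exchange_big big1 // => i _.
  have [m0 _] := mP X`_i.
  have -> : coord X i x^-1 *: X`_i = (coord X i x^-1 / (m X`_i)%:~R) *: ((m X`_i)%:~R * X`_i).
    by rewrite mulrz_scale scalerA divfK // intr_eq0.
  under eq_bigr => s _ do rewrite -scalerAr linearZ /=.
  by rewrite -scaler_sumr -galTraceE x0 scaler0.
rewrite divff // galTraceE; under eq_bigr => s _ do rewrite rmorph1.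
move/eqP; rewrite sumr_const pmulrn intrL_eq0 => /eqP[]/eqP.
by rewrite -leqn0 leqNgt; case/negP; apply/card_gt0P; exists 1%g.
Qed.

(** An element is determined by its traces against the integral basis; along [f] these are integers
    bounded in terms of [B], so they take finitely many values. *)
Lemma northcott (B : algC) (f : nat -> L) :
    (forall k, integral (f k)) -> (forall k s, `|iota (s (f k))| <= B) ->
  exists i j, (i < j)%N /\ f i = f j.
Proof.
move=> f_int f_le; have [b [b_int _ b_tr]] := exists_integral_basis.
have [T TE] := choice (fun ki => integral_galTrace (integralM (f_int ki.1) (b_int ki.2))).
pose C := \sum_i \sum_(s : gT) B * `|iota (s (b i))|.
have B0 : 0 <= B := le_trans (normr_ge0 _) (f_le 0 1%g).
have C0 i : 0 <= \sum_(s : gT) B * `|iota (s (b i))|.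
  by apply: sumr_ge0 => s _; rewrite mulr_ge0.
pose M := Num.bound C.
have T_le k i : (`|T (k, i)| <= M)%N.
  suff : `|(T (k, i))%:~R| <= C.
    have C_ge0 : 0 <= C by apply: sumr_ge0.
    move=> /le_lt_trans/(_ (archi_boundP C_ge0)).
    by rewrite -intr_norm -abszE -pmulrn ltr_nat => /ltnW.
  rewrite -(rmorph_int iota) -TE galTraceE rmorph_sum.
  apply: le_trans (ler_norm_sum _ _ _) _; rewrite /C (bigD1 i) //=.
  apply: ler_wpDr; first by apply: sumr_ge0.
  by apply: ler_sum => s _; rewrite /= !rmorphM normrM ler_wpM2r ?f_le.
(* Adding [M] makes the traces natural numbers at most [M + M]. *)
pose key k : {ffun 'I_(\dim {:L}) -> 'I_(M + M).+1} :=
  [ffun i => inord `|(T (k, i) + M%:Z)%R|%N].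
have [i [j [ij eq_key]]] := pigeonhole_nat key.
exists i, j; split=> //; apply/eqP; rewrite -subr_eq0; apply/eqP/b_tr => l.
have eqT : T (i, l) = T (j, l).
  move/ffunP/(_ l)/(congr1 val): eq_key; rewrite !ffunE /= !inordK.
  - by have := T_le i l; have := T_le j l; lia.
  - by have := T_le j l; lia.
  - by have := T_le i l; lia.
rewrite mulrBl galTraceE; under eq_bigr => s _ do rewrite rmorphB.
by rewrite sumrB -!galTraceE (TE (i, l)) (TE (j, l)) eqT subrr.
Qed.
End Northcott.

(** * Logarithms of units *)

Section Logarithms.
Variables (R : realType) (L : splittingFieldType rat).
Variable iota : {rmorphism L -> algC}.
Local Notation gT := (gal_of (fullv : {vspace L})).
Implicit Types (x y : L) (s t : gT).

(** Indexed by the whole Galois group and not by places: a complex place is met twice, at [s] and at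
    [s] followed by complex conjugation. *)
Definition lg x s : R := log2 R `|iota (s x)|.

Lemma norm_gal_gt0 x s : x != 0 -> 0 < `|iota (s x)|.
Proof. by move=> x0; rewrite normr_gt0 !fmorph_eq0. Qed.

Lemma is_unit_neq0 x : is_unit_int x -> x != 0.
Proof. by case. Qed.

Lemma lgM x y s : x != 0 -> y != 0 -> lg (x * y) s = lg x s + lg y s.
Proof. by move=> x0 y0; rewrite /lg !rmorphM normrM log2M // norm_gal_gt0. Qed.

Lemma lgV x s : x != 0 -> lg x^-1 s = - lg x s.
Proof. by move=> x0; rewrite /lg !fmorphV normfV log2V // norm_gal_gt0. Qed.

Lemma lg1 s : lg 1 s = 0.
Proof. by rewrite /lg !rmorph1 normr1 log2_1. Qed.

Lemma lg_prod (I : Type) (r : seq I) (P : pred I) (F : I -> L) s :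
  (forall i, P i -> F i != 0) ->
  lg (\prod_(i <- r | P i) F i) s = \sum_(i <- r | P i) lg (F i) s.
Proof.
move=> F0; rewrite /lg !rmorph_prod normr_prod log2_prod // => i Pi.
by rewrite norm_gal_gt0 // F0.
Qed.

Lemma lgXz x (m : int) s : x != 0 -> lg (x ^ m) s = m%:~R * lg x s.
Proof.
move=> x0; rewrite -log2Xz ?norm_gal_gt0 // /lg !fmorphXz; congr (log2 R _).
by case: m => n; rewrite ?NegzE -?exprnN ?normfV normrX.
Qed.

(** Conjugating [x] translates its logarithm on the left, which turns combinations of conjugates
    into convolutions. *)
Lemma lg_gal x s t : lg (t x) s = lg x (t * s)%g.
Proof. by rewrite /lg galMfull. Qed.

Lemma lg_conj (c : gT) x s : (forall y, iota (c y) = (iota y)^*) -> lg x (s * c)%g = lg x s.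
Proof. by move=> cE; rewrite /lg galMfull cE norm_conjC. Qed.

Lemma lg_root_of_unity x s : root_of_unity x -> lg x s = 0.
Proof.
move=> xr; have x0 := is_unit_neq0 (root_of_unity_is_unit xr).
case: xr => n n0 xn; have := lgXz n s x0.
rewrite -exprnP xn lg1 => /esym/eqP; rewrite mulf_eq0.
by rewrite intr_eq0 eqz_nat gtn_eqF //= => /eqP.
Qed.

(** The norm of a unit is a rational integer with an integer inverse, hence 1 or -1. *)
Lemma sum_lg_unit x : is_unit_int x -> \sum_s lg x s = 0.
Proof.
move=> xu; rewrite -log2_prod; last by move=> s _; rewrite norm_gal_gt0 ?is_unit_neq0.
rewrite -normr_prod -rmorph_prod -galNormE.
have [x0 [/(integral_galNorm iota)[m mE] /(integral_galNorm iota)[m' m'E]]] := xu.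
have : m * m' = 1.
  apply: (@intrL_inj L); rewrite intrM -mE -m'E -galNormM divff // galNorm1.
  by rewrite mulr1z.
move/(congr1 absz)/eqP; rewrite abszM muln_eq1 => /andP[/eqP m1 _].
by rewrite mE rmorph_int -intr_norm -abszE m1 log2_1.
Qed.

Definition logrow x : 'rV[R]_#|{: gT}| := \row_i lg x (enum_val i).

Definition logmx n (u : 'I_n -> L) : 'M[R]_(n, #|{: gT}|) :=
  \matrix_k logrow (u k).

Lemma sum_enum_val (F : gT -> R) : \sum_(i < #|{: gT}|) F (enum_val i) = \sum_s F s.
Proof.
rewrite [RHS](reindex_onto enum_val enum_rank) /= => [|s _]; last by rewrite enum_rankK.
by apply: eq_bigl => i; rewrite enum_valK eqxx.
Qed.

Lemma mul_logmx n (u : 'I_n -> L) (v : 'rV_n) i :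
  (v *m logmx u) 0 i = \sum_k v 0 k * lg (u k) (enum_val i).
Proof. by rewrite mxE; apply: eq_bigr => k _; rewrite !mxE. Qed.

Lemma row_free_mult_indep n (u : 'I_n -> L) :
  (forall i, is_unit_int (u i)) -> row_free (logmx u) -> mult_indep u.
Proof.
move=> uu u_free e ue k.
have : \row_k (e k)%:~R *m logmx u = 0.
  apply/rowP => i; rewrite mul_logmx !mxE; apply: etrans (lg_root_of_unity (enum_val i) ue).
  rewrite lg_prod => [|j _]; last by rewrite expfz_neq0 // is_unit_neq0.
  by apply: eq_bigr => j _; rewrite mxE lgXz // is_unit_neq0.
rewrite -(mul0mx _ (logmx u)) => /(row_free_inj u_free)/rowP/(_ k).
by rewrite !mxE => /eqP; rewrite intr_eq0 => /eqP.
Qed.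

(* Rounding down the multiples of a real linear relation gives infinitely many
   monomials in the [u i] with bounded conjugates, so two of them coincide. *)
Lemma mult_indep_row_free n (u : 'I_n -> L) :
  (forall i, is_unit_int (u i)) -> mult_indep u -> row_free (logmx u).
Proof.
move=> uu u_indep; apply: inj_row_free => v v0; apply/rowP => k0; rewrite mxE.
apply/eqP; apply: contraT => vk0.
(* Normalised so that [a k0 = 1]: the exponent of [u k0] in [x N] is then [N], and equal monomials
   for distinct [N] give a nontrivial relation. *)
pose a k := v 0 k / v 0 k0.
have a0 s : \sum_k a k * lg (u k) s = 0.
  under eq_bigr => k _ do rewrite mulrAC.
  rewrite -mulr_suml; move/rowP/(_ (enum_rank s)): v0.
  by rewrite mul_logmx enum_rankK mxE => ->; rewrite mul0r.
pose x (N : nat) := \prod_k u k ^ Num.floor (N%:R * a k).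
have u0 k : u k != 0 by exact: is_unit_neq0.
pose C := \sum_k \sum_s `|lg (u k) s|.
have C0 : 0 <= C by rewrite !sumr_ge0 // => k _; rewrite sumr_ge0.
have lg_x N s : lg (x N) s <= C.
  rewrite lg_prod => [|k _]; last by rewrite expfz_neq0.
  (* Subtracting [N] times the linear relation leaves minus the fractional parts as coefficients,
     hence a bound independent of [N]. *)
  have -> : \sum_k lg (u k ^ Num.floor (N%:R * a k)) s =
     \sum_k ((Num.floor (N%:R * a k))%:~R - N%:R * a k) * lg (u k) s.
    transitivity (\sum_k lg (u k ^ Num.floor (N%:R * a k)) s -
                  N%:R * \sum_k a k * lg (u k) s).
      by rewrite a0 mulr0 subr0.
    rewrite mulr_sumr -sumrB.
    by apply: eq_bigr => k _; rewrite lgXz // mulrBl mulrA.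
  apply: ler_sum => k _; rewrite (bigD1 s) //=; apply: ler_wpDr.
    by rewrite sumr_ge0.
  apply: le_trans (ler_norm _) _; rewrite normrM ler_piMl //.
  have /andP[] := floor_itv (N%:R * a k).
  by rewrite rmorphD rmorph1 => h1 h2; rewrite ler_norml; apply/andP; split; lra.
have log2_2 : 0 < log2 R 2 by apply: log2_gt0; rewrite ltr1n.
pose b := Num.bound (C / log2 R 2).
have x_int N : is_unit_int (x N) by apply: is_unit_int_prod => k _; exact: is_unit_intXz.
have [||N [N' [ltNN' eqx]]] := northcott (iota := iota) (B := 2 ^+ b) (f := x).
- by move=> N; have [_ []] := x_int N.
- move=> N s; rewrite -(log2_mono R) ?posrE ?exprn_gt0 ?norm_gal_gt0 ?is_unit_neq0 //.
  apply: le_trans (lg_x N s) _; rewrite exprnP log2Xz // -ler_pdivrMr //.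
  by apply/ltW/archi_boundP; rewrite divr_ge0 // ltW.
have : root_of_unity (\prod_k u k ^ (Num.floor (N'%:R * a k) - Num.floor (N%:R * a k))).
  exists 1%N => //; rewrite expr1.
  under eq_bigr => k _ do rewrite expfzDr // -invr_expz.
  by rewrite big_split /= prodfV -/(x N) -/(x N') eqx divff // is_unit_neq0.
move/u_indep/(_ k0).
rewrite /a divff // !mulr1 !pmulrn !intrKfloor.
by move/eqP; rewrite subr_eq0 eqz_nat gtn_eqF.
Qed.

End Logarithms.

(** * A unit that is small outside one place *)

Section DirichletUnit.
Variable L : splittingFieldType rat.
Variable iota : {rmorphism L -> algC}.
Local Notation gT := (gal_of (fullv : {vspace L})).
Local Notation d := (\dim {:L}).
Implicit Types (x y : L) (s t : gT).

Variables (c : gT) (b : 'I_d -> L).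
Hypotheses (cc : (c * c = 1)%g) (cE : forall x, iota (c x) = (iota x)^*).
Hypotheses (b_int : forall i, integral (b i))
  (b_free : forall a : 'I_d -> int, \sum_i (a i)%:~R * b i = 0 -> forall i, a i = 0).

Let D : {set gT} := [set 1%g; c].
Let lin (a : 'I_d -> int) : L := \sum_i (a i)%:~R * b i.

(* For a pair of conjugate places, the values of this real linear form at [s]
   and at [s * c] are the sum and the difference of the real and imaginary
   parts, so it controls complex places without choosing one from each pair. *)
Let form s x : algC := 'Re (iota (s x)) + 'Im (iota (s x)).

Let form_real s x : form s x \is Num.real.
Proof. by rewrite rpredD ?Creal_Re ?Creal_Im. Qed.

Let formB s x y : form s (x - y) = form s x - form s y.
Proof. by rewrite /form !rmorphB /= !raddfB /=; ring. Qed.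

Let form_conj s x : form (s * c)%g x = 'Re (iota (s x)) - 'Im (iota (s x)).
Proof. by rewrite /form galMfull cE Re_conj Im_conj. Qed.

Let norm_le_forms s x : `|iota (s x)| <= `|form s x| + `|form (s * c)%g x|.
Proof.
rewrite form_conj /form; set z := iota (s x).
have double (u v w : algC) : u + u = v + w -> `|u| + `|u| <= `|v| + `|w|.
  by move=> uvw; rewrite -mulr2n -normrMn mulr2n uvw ler_normD.
have leRI : `|z| <= `|'Re z| + `|'Im z|.
  rewrite {1}(Crect z); apply: le_trans (ler_normD _ _) _.
  by rewrite normrM normCi mul1r.
apply: le_trans leRI _; rewrite -(ler_pM2l (ltr0n _ 2)) !mulr_natl !mulr2n addrACA.
by apply: lerD; [|rewrite -[`|_ - _|]normrN]; apply: double; ring.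
Qed.

Let notinD_c s : s \notin D -> (s * c)%g \notin D.
Proof.
apply: contra; rewrite !inE => /orP[] /eqP sc; apply/orP; [right | left].
  by rewrite -(inj_eq (mulIg c)) sc cc.
by rewrite -(inj_eq (mulIg c)) sc mul1g.
Qed.

Let B : nat := Num.bound (\sum_i \sum_(s : gT) `|iota (s (b i))| : algC).
(** Chosen so that two forms bounded by [(2 * W + 1) / m], with [W = M * (B + B)], add up to at most
    [A * M / m]; it does not depend on [eps]. *)
Let A : algC := 2 * (2 * (B + B)%:R + 1).

Let B0 : 0 <= \sum_i \sum_(s : gT) `|iota (s (b i))|.
Proof. by rewrite !sumr_ge0 // => i _; rewrite sumr_ge0. Qed.

Let norm_lin a s (M : nat) : (forall i, (`|a i| <= M)%N) ->
  `|iota (s (lin a))| <= M%:R * B%:R.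
Proof.
move=> aM; rewrite !rmorph_sum; apply: le_trans (ler_norm_sum _ _ _) _.
apply: (@le_trans _ _ (M%:R * \sum_i \sum_(s : gT) `|iota (s (b i))|)); last first.
  by rewrite ler_wpM2l // ltW // archi_boundP.
rewrite mulr_sumr; apply: ler_sum => i _.
rewrite !rmorphM !rmorph_int normrM -intr_norm -abszE -pmulrn.
apply: ler_pM => //; first by rewrite ler_nat.
by rewrite (bigD1 s) //= ler_wpDr ?sumr_ge0.
Qed.

Let norm_form s x : `|form s x| <= 2 * `|iota (s x)|.
Proof.
apply: le_trans (ler_normD _ _) _; rewrite mulr_natl mulr2n lerD //.
  by have [->] := leif_normC_Re_Creal (iota (s x)).
have [+ _] := leif_normC_Re_Creal ('i * iota (s x)).
by rewrite ReMil normrN normrM normCi mul1r.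
Qed.

(** The box principle for the values of [form] outside [D], on combinations of the [b i] with
    coefficients from 0 to [M]. Conjugates of a difference are at most [A * M] on [D] and
    [A * M / m] elsewhere, and [M ^ d = m ^ e] bounds the norm by [A ^+ d] whatever [eps] is. *)
Lemma exists_small_integral (eps : algC) : 0 < eps ->
  exists a : 'I_d -> int, [/\ lin a != 0,
    forall s, s \notin D -> `|iota (s (lin a))| < eps
  & `|iota (galNorm 1%AS {:L} (lin a))| <= A ^+ d].
Proof.
move=> eps0; have A0 : 0 < A by rewrite mulr_gt0 ?ltr0n // ltr_wpDl ?ltr01 ?mulr_ge0.
pose e := #|~: D|.
have de : d = (#|D| + e)%N by rewrite -card_gal_full cardsC.
have D_gt0 : (0 < #|D|)%N by apply/card_gt0P; exists 1%g; rewrite !inE eqxx.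
have d_gt0 : (0 < d)%N by rewrite de addn_gt0 D_gt0.
(* Then [m ^ e = M ^ d < M.+1 ^ d], so two coefficient vectors share a box, while [M / m] is [k] to
   the power [- #|D|], at most [1 / k]. *)
pose k := (Num.bound (A / eps)).+1; pose M := (k ^ e)%N; pose m := (k ^ d)%N.
have k_gt0 : (0 < k)%N by [].
have m_gt0 : (0 < m)%N by rewrite expn_gt0.
have M_gt0 : (0 < M)%N by rewrite expn_gt0.
pose al (f : {ffun 'I_d -> 'I_M.+1}) := lin (fun i => (f i : nat)%:Z).
pose W : algC := M%:R * (B + B)%:R.
have W0 : 0 <= W by rewrite mulr_ge0.
have W1 : 0 < 2 * W + 1 by rewrite ltr_wpDl ?ltr01 ?mulr_ge0.
have form_al f s : - W <= form s (al f) <= W.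
  rewrite -real_ler_norml //; apply: le_trans (norm_form _ _) _.
  have -> : W = 2 * (M%:R * B%:R) by rewrite /W natrD; ring.
  rewrite ler_pM2l ?ltr0n //.
  by apply: norm_lin => i; rewrite absz_nat -ltnS.
(* Moves the form from [[- W, W]] into [[0, m)]; the [+ 1] in the denominator makes the upper end
   strict. *)
pose scaled f s := (form s (al f) + W) * m%:R / (2 * W + 1).
have scaled_itv f s : 0 <= scaled f s < m%:R.
  have /andP[h1 h2] := form_al f s.
  have h3 : 0 <= form s (al f) + W by rewrite -lerBlDr sub0r.
  rewrite divr_ge0 ?(ltW W1) ?mulr_ge0 //= ltr_pdivrMr // mulrC ltr_pM2l ?ltr0n //.
  by rewrite ltr_pwDr ?ltr01 // mulr_natl mulr2n lerD2r.
have scaled_real f s : scaled f s \is Num.real.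
  by rewrite ger0_real //; case/andP: (scaled_itv f s).
pose key (f : {ffun 'I_d -> 'I_M.+1}) : {ffun {s : gT | s \in ~: D} -> 'I_m.-1.+1} :=
  [ffun s => inord `|Num.floor (scaled f (val s))|%N].
have [|f [f' [ff' eq_key]]] := pigeonhole key.
  rewrite !card_ffun !card_ord prednK // card_sig.
  rewrite (eq_card (B := ~: D)) // -/e /m -expnM mulnC expnM -/M.
  by rewrite ltn_exp2r.
have al_sub : al f - al f' = lin (fun i => (f i : nat)%:Z - (f' i : nat)%:Z).
  by rewrite -sumrB; apply: eq_bigr => i _; rewrite intrB mulrBl.
set a := fun i => _ in al_sub.
have al_le s : `|iota (s (lin a))| <= A * M%:R.
  apply: le_trans (norm_lin (M := M) s _) _.
    by move=> i; rewrite /a; have := ltn_ord (f i); have := ltn_ord (f' i); lia.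
  rewrite mulrC ler_wpM2r // /A natrD.
  by rewrite -subr_ge0 (_ : _ - _ = 7 * B%:R + 2) ?addr_ge0 ?mulr_ge0 //; ring.
have al_lt s : s \notin D -> `|iota (s (lin a))| <= A * M%:R / m%:R.
  move=> sD.
  have form_le t : t \notin D -> `|form t (lin a)| <= (2 * W + 1) / m%:R.
    move=> tD; rewrite -al_sub formB.
    have tD' : t \in ~: D by rewrite inE.
    have /ffunP/(_ (exist _ t tD'))/(congr1 val) := eq_key.
    have floor_itv g : (0 <= Num.floor (scaled g t)) /\ (`|Num.floor (scaled g t)| < m)%N.
      have /andP[h1 h2] := scaled_itv g t.
      have h3 : 0 <= Num.floor (scaled g t) by rewrite real_floor_ge_int.
      split=> //; rewrite -(ltr_nat algC); apply: le_lt_trans h2.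
      by rewrite pmulrn gez0_abs //; have /andP[] := real_floor_itv (scaled_real g t).
    have [h1 h2] := floor_itv f; have [h3 h4] := floor_itv f'.
    rewrite !ffunE /= !inordK ?prednK // => eq_abs.
    have eq_floor : Num.floor (scaled f t) = Num.floor (scaled f' t) by lia.
    have : `|scaled f t - scaled f' t| <= 1.
      have := real_floor_itv (scaled_real f' t).
      have := real_floor_itv (scaled_real f t).
      rewrite eq_floor rmorphD rmorph1; set q := _%:~R => /andP[i1 i2] /andP[i3 i4].
      have di : scaled f t - scaled f' t <= q + 1 - q by rewrite lerB // ltW.
      have di' : q - (q + 1) <= scaled f t - scaled f' t by rewrite lerB // ltW.
      rewrite real_ler_norml ?rpredB //; apply/andP; split.
        by apply: le_trans di'; rewrite opprD addrA subrr sub0r.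
      by apply: le_trans di _; rewrite addrAC subrr add0r.
    have -> : scaled f t - scaled f' t =
        (form t (al f) - form t (al f')) * (m%:R / (2 * W + 1)).
      by rewrite /scaled; ring.
    rewrite normrM [X in _ * X]ger0_norm ?divr_ge0 ?(ltW W1) //.
    by rewrite -ler_pdivlMr ?divr_gt0 ?ltr0n // div1r invf_div.
  apply: le_trans (norm_le_forms _ _) _.
  apply: le_trans (lerD (form_le _ sD) (form_le _ (notinD_c sD))) _.
  rewrite -mulrDl ler_pM2r ?invr_gt0 ?ltr0n //.
  have -> : A * M%:R = (2 * W + 1) + (2 * W + 1) + 2 * (M%:R - 1) by rewrite /A /W; ring.
  by rewrite lerDl mulr_ge0 // subr_ge0 ler1n.
exists a; split.
- apply/eqP => /b_free a0; case/eqP: ff'; apply/ffunP => i; apply/val_inj.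
  by have /eqP := a0 i; rewrite subr_eq0 eqz_nat => /eqP.
- move=> s /al_lt /le_lt_trans; apply.
  rewrite ltr_pdivrMr ?ltr0n //; apply: (@lt_le_trans _ _ (eps * (k%:R * M%:R))).
    rewrite mulrA ltr_pM2r ?ltr0n // mulrC -ltr_pdivrMr //.
    apply: lt_trans (archi_boundP _) _; first by rewrite divr_ge0 ?ltW.
    by rewrite ltr_nat.
  by rewrite ler_pM2l // -natrM ler_nat -expnS leq_pexp2l // de -add1n leq_add2r.
rewrite galNormE rmorph_prod normr_prod.
pose F s := if s \in D then A * M%:R else A * M%:R / m%:R.
apply: (@le_trans _ _ (\prod_s F s)).
  apply: ler_prod => s _; rewrite normr_ge0 /= /F.
  by case: ifPn => [_|/al_lt].
rewrite (bigID (mem D)) /= /F.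
rewrite (eq_bigr (fun _ => A * M%:R)) => [|s ->//].
rewrite [X in _ * X](eq_bigr (fun _ => A * M%:R / m%:R)) => [|s /negPf->//].
rewrite !prodr_const [X in _ * _ ^+ X](eq_card (B := ~: D)) => [|s]; last by rewrite in_setC.
rewrite -/e expr_div_n mulrA -exprD -de exprMn.
by rewrite -!natrX -!expnM mulnC mulfK // pnatr_eq0 -lt0n expn_gt0.
Qed.

Let lin_int a : integral (lin a).
Proof. by apply: integral_sum => i _; apply: integralM (integral_intr _ _) (b_int i). Qed.

Let norm_div x : x != 0 -> integral x -> integral (galNorm 1%AS {:L} x / x).
Proof.
move=> x0 xi; rewrite galNormE (bigD1 1%g) //= gal_id mulrC mulKf //.
by apply: integral_prod => s _; apply: integral_gal.
Qed.

(* Integers with the same norm [N] that are congruent modulo [N] are associate. *)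
Let quotient_integral x y z (N : int) :
  x != 0 -> integral x -> integral z -> galNorm 1%AS {:L} x = N%:~R ->
  y = x + N%:~R * z -> integral (y / x).
Proof.
move=> x0 xi zi xN ->; rewrite mulrDl divff //; apply: integralD; first exact: integral1.
by rewrite mulrAC; apply: integralM => //; rewrite -xN; apply: norm_div.
Qed.

(** Repeated use of [exists_small_integral] gives integers of bounded norm whose conjugates outside
    [D] keep decreasing. Two of them have the same norm and coefficients congruent modulo it, and
    their quotient is a unit. *)
Lemma exists_unit_lt1_outside :
  exists2 u : L, is_unit_int u & forall s, s \notin D -> `|iota (s u)| < 1.
Proof.
have next x : exists a : 'I_d -> int, x != 0 -> [/\ lin a != 0,
    forall s, s \notin D -> `|iota (s (lin a))| < `|iota (s x)|
  & `|iota (galNorm 1%AS {:L} (lin a))| <= A ^+ d].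
  have [->|x0] := eqVneq x 0; first by exists (fun=> 0).
  (* A positive lower bound for the absolute values of all conjugates of [x]. *)
  pose eps := (\sum_(s : gT) `|iota (s x)|^-1)^-1.
  have pos s : 0 < `|iota (s x)|^-1 by rewrite invr_gt0 normr_gt0 !fmorph_eq0.
  have le_inv s : `|iota (s x)|^-1 <= \sum_(s : gT) `|iota (s x)|^-1.
    by rewrite (bigD1 s) //= lerDl sumr_ge0 // => t _; rewrite ltW.
  have sum_gt0 : 0 < \sum_(s : gT) `|iota (s x)|^-1 by apply: lt_le_trans (le_inv 1%g).
  have eps0 : 0 < eps by rewrite invr_gt0.
  have [a [a0 alt aN]] := exists_small_integral eps0; exists a => _; split=> // s sD.
  apply: lt_le_trans (alt s sD) _.
  by rewrite /eps -[leRHS]invrK lef_pV2 ?posrE.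
have [f fP] := choice next.
pose al k := iter k (fun a => f (lin a)) (f 1).
have al0 k : lin (al k) != 0.
  by elim: k => [|k IHk] /=; [have [] := fP 1 (oner_neq0 _) | have [] := fP _ IHk].
have alN k : `|iota (galNorm 1%AS {:L} (lin (al k)))| <= A ^+ d.
  by case: k => [|k] /=; [have [] := fP 1 (oner_neq0 _) | have [] := fP _ (al0 k)].
have al_lt i j s : (i < j)%N -> s \notin D ->
    `|iota (s (lin (al j)))| < `|iota (s (lin (al i)))|.
  move=> ij sD; have al_step k : `|iota (s (lin (al k.+1)))| < `|iota (s (lin (al k)))|.
    by have [_ + _] := fP _ (al0 k); apply.
  elim: j ij => // j IHj; rewrite ltnS leq_eqVlt => /orP[/eqP->|/IHj]; first exact: al_step.
  exact: lt_trans (al_step j).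
have [N NE] := choice (fun k => integral_galNorm iota (lin_int (al k))).
have N0 k : N k != 0 by rewrite -(intrL_eq0 L) -NE galNorm_eq0 al0.
pose C := Num.bound (A ^+ d).
have N_le k : (`|N k| <= C)%N.
  have A0 : 0 <= A ^+ d := le_trans (normr_ge0 _) (alN 0%N).
  have := le_lt_trans (alN k) (archi_boundP A0).
  by rewrite NE rmorph_int -intr_norm -abszE -pmulrn ltr_nat => /ltnW.
pose key k : 'I_(C + C).+1 * {ffun 'I_d -> 'I_C.+1} :=
  (inord `|(N k + C%:Z)%R|%N, [ffun i => inord `|(al k i %% N k)%Z|%N]).
have [i [j [ij]]] := pigeonhole_nat key.
case=> /(congr1 val) /= eqN /ffunP eq_mod.
have eqNij : N i = N j.
  move: eqN; rewrite !inordK; have := N_le i; have := N_le j; lia.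
have mod_lt k l : (`|(al k l %% N k)%Z| < C.+1)%N.
  rewrite ltnS; apply: leq_trans (N_le k); apply: ltnW.
  by rewrite -ltz_nat gez0_abs ?modz_ge0 // ltz_mod.
have eq_modij l : (al i l %% N i)%Z = (al j l %% N i)%Z.
  move: (eq_mod l); rewrite !ffunE => /(congr1 val) /=; rewrite !inordK // -eqNij.
  have := modz_ge0 (al i l) (N0 i); have := modz_ge0 (al j l) (N0 i); lia.
pose z := lin (fun l => (al j l %/ N i)%Z - (al i l %/ N i)%Z).
have eq_ij : lin (al j) = lin (al i) + (N i)%:~R * z.
  rewrite mulr_sumr -big_split /=; apply: eq_bigr => l _.
  rewrite mulrA -mulrDl -intrM -intrD; congr (_%:~R * _).
  by rewrite {1}(divz_eq (al j l) (N i)) {1}(divz_eq (al i l) (N i)) eq_modij; ring.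
have eq_ji : lin (al i) = lin (al j) + (N i)%:~R * - z by rewrite eq_ij mulrN addrK.
exists (lin (al j) / lin (al i)).
  split; first by rewrite mulf_neq0 ?invr_eq0 ?al0.
  split; first exact: quotient_integral (al0 i) (lin_int _) (lin_int _) (NE i) eq_ij.
  rewrite invf_div; apply: quotient_integral (al0 j) (lin_int _) _ _ eq_ji.
    by rewrite -mulN1r -(mulrN1z 1); apply: integralM (integral_intr _ _) (lin_int _).
  by rewrite eqNij; exact: NE.
move=> s sD; rewrite !fmorph_div normf_div ltr_pdivrMr ?mul1r; first exact: al_lt.
by rewrite normr_gt0 !fmorph_eq0.
Qed.

End DirichletUnit.

(** * The logarithms of a basis of units *)

Lemma row_free_rowsub (F : fieldType) m n p (f : 'I_m -> 'I_n) (A : 'M[F]_(n, p)) :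
  injective f -> row_free A -> row_free (rowsub f A).
Proof.
move=> f_inj A_free; apply: inj_row_free => v.
rewrite rowsubE mulmxA -(mul0mx _ A) => /(row_free_inj A_free)/rowP v0.
apply/rowP => k; have := v0 (f k).
rewrite !mxE (bigD1 k) //= !mxE eqxx mulr1 big1 ?addr0 // => j jk.
by rewrite !mxE (inj_eq f_inj) (negPf jk) mulr0.
Qed.

Section LogarithmicSpan.
Variables (R : realType) (L : splittingFieldType rat).
Variable iota : {rmorphism L -> algC}.
Local Notation gT := (gal_of (fullv : {vspace L})).
Local Notation lg := (lg R iota).
Local Notation logmx := (logmx R iota).
Implicit Types (x y : L) (s t : gT).

(** Units whose logarithms are independent over R are multiplicatively independent, so the real rank
    bounds the rank of the group from below. *)
Lemma rank_mult_indep n (u : 'I_n -> L) r :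
    (forall i, is_unit_int (u i)) -> (r <= \rank (logmx u))%N ->
  exists f : 'I_r -> 'I_n, mult_indep (u \o f).
Proof.
move=> uu le_r; pose f := maxrankfun (logmx u) \o widen_ord le_r.
exists f; apply: (row_free_mult_indep (R := R) (iota := iota)) => [i|]; first exact: uu.
have -> : logmx (u \o f) = rowsub (widen_ord le_r) (rowsub (maxrankfun (logmx u)) (logmx u)).
  by apply/matrixP => i j; rewrite !mxE.
apply: row_free_rowsub (maxrowsub_free _) => i j /(congr1 val) ij; exact: val_inj.
Qed.

Variables (r : nat) (eta : 'I_r -> L).
Hypothesis eta_basis : is_basis_F eta.

Lemma lg_basis x : is_unit_int x ->
  exists e : 'I_r -> int, forall s, lg x s = \sum_j (e j)%:~R * lg (eta j) s.
Proof.
have [eta_unit [_ gen]] := eta_basis => xu; have [e xe] := gen x xu.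
exists e => s; have eta0 j : eta j != 0 by exact: is_unit_neq0.
have := lg_root_of_unity R iota s xe.
have p0 : \prod_j eta j ^ e j != 0 by apply/prodf_neq0 => j _; rewrite expfz_neq0.
rewrite lgM ?invr_eq0 ?(is_unit_neq0 xu) // lgV // => /eqP; rewrite subr_eq0 => /eqP ->.
rewrite lg_prod => [|j _]; last by rewrite expfz_neq0 ?eta0.
by apply: eq_bigr => j _; rewrite lgXz ?eta0.
Qed.

Lemma logmx_sub_basis n (u : 'I_n -> L) :
  (forall i, is_unit_int (u i)) -> (logmx u <= logmx eta)%MS.
Proof.
move=> uu; apply/row_subP => i; have [e ee] := lg_basis (uu i).
apply/submxP; exists (\row_j (e j)%:~R); apply/rowP => k.
by rewrite mul_logmx !mxE ee; apply: eq_bigr => j _; rewrite mxE.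
Qed.

(* A function [g] orthogonal to the logarithms of all units, symmetrised under
   [c], attains its maximum; pairing it with the conjugate of a unit that has a
   single place of absolute value above 1 forces it to be constant. *)
Lemma log_units_span (c : gT) (f : gT -> R) :
    (c * c = 1)%g -> (forall x, iota (c x) = (iota x)^*) ->
    (forall s, f (s * c)%g = f s) -> \sum_s f s = 0 ->
  exists b : 'I_r -> R, forall s, f s = \sum_j b j * lg (eta j) s.
Proof.
move=> cc cE fc f_sum.
have [b [b_int b_free _]] := exists_integral_basis L.
have [u uu u_lt1] := exists_unit_lt1_outside cc cE b_int b_free.
have /submxP[v vE] : (\row_i f (enum_val i) <= logmx eta)%MS.
  rewrite submxE; apply/eqP/rowP => k; rewrite !mxE.
  (* A column of the cokernel is a linear form vanishing on the logarithms of all units; [f] lies in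
     their span once every such form kills it. *)
  pose g s := cokermx (logmx eta) (enum_rank s) k.
  have g_eta j : \sum_s lg (eta j) s * g s = 0.
    have /matrixP/(_ j k) := mulmx_coker (logmx eta).
    rewrite !mxE; apply: etrans; rewrite -sum_enum_val; apply: eq_bigr => i _.
    by congr (_ * _); [rewrite !mxE | rewrite /g enum_valK].
  have g_unit x : is_unit_int x -> \sum_s lg x s * g s = 0.
    move=> /lg_basis[e ee]; under eq_bigr => s _ do rewrite ee mulr_suml.
    rewrite exchange_big big1 //= => j _.
    by under eq_bigr => s _ do rewrite -mulrA; rewrite -mulr_sumr g_eta mulr0.
  pose g' s := g s + g (s * c)%g.
  have g'c s : g' (s * c)%g = g' s by rewrite /g' -mulgA cc mulg1 addrC.
  have sum_g' (F : gT -> R) : (forall s, F (s * c)%g = F s) ->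
      \sum_s F s * g' s = (\sum_s F s * g s) *+ 2.
    move=> Fc; rewrite mulr2n [X in _ = _ + X](reindex_inj (mulIg c)) /= -big_split /=.
    by apply: eq_bigr => s _; rewrite Fc mulrDr.
  have [s0 s0_max] : exists s0, forall s, g' s <= g' s0.
    case: (Order.TotalTheory.arg_maxP (P := predT) g' (i0 := 1%g) isT) => s0 _ max_s0.
    by exists s0 => s; apply: max_s0.
  have g'_const s : g' s = g' s0.
    (* The first factor vanishes on [s0] times {1, c}; elsewhere the logarithm is negative and [g']
       is maximal at [s0]. *)
    have terms t : 0 <= (g' s0 - g' t) * - lg (s0^-1%g u) t.
      rewrite lg_gal; have [|/u_lt1 lt1] := boolP ((s0^-1 * t)%g \in [set 1%g; c]).
        rewrite !inE => /orP[] /eqP/(canRL (mulKVg _)) ->.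
          by rewrite mulg1 subrr mul0r.
        by rewrite g'c subrr mul0r.
      rewrite mulr_ge0 ?subr_ge0 ?oppr_ge0 // ltW // /lg log2_lt0 //.
      by rewrite norm_gal_gt0 // is_unit_neq0.
    have su : is_unit_int (s0^-1%g u) by exact: is_unit_int_gal.
    (* Logarithms of units sum to 0 and are orthogonal to [g'], so these nonnegative terms all
       vanish. *)
    have : \sum_t (g' s0 - g' t) * - lg (s0^-1%g u) t = 0.
      under eq_bigr => t _ do rewrite mulrN mulrBl opprB mulrC.
      rewrite sumrB -mulr_sumr (sum_lg_unit _ _ su) mulr0 subr0 sum_g'.
        by rewrite g_unit // mul0rn.
      by move=> t; rewrite lg_conj.
    move/psumr_eq0P => /(_ (fun t _ => terms t))/(_ s isT)/eqP.
    rewrite mulf_eq0 subr_eq0 => /orP[/eqP-> //|].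
    rewrite lg_gal oppr_eq0.
    have [|/u_lt1 lt1] := boolP ((s0^-1 * s)%g \in [set 1%g; c]).
      rewrite !inE => /orP[] /eqP/(canRL (mulKVg _)) ->; first by rewrite mulg1.
      by rewrite g'c.
    by rewrite lt_eqF // /lg log2_lt0 // norm_gal_gt0 // is_unit_neq0.
  have : (\sum_s f s * g s) *+ 2 = 0.
    rewrite -sum_g' //; under eq_bigr => s _ do rewrite g'_const.
    by rewrite -mulr_suml f_sum mul0r.
  move/eqP; rewrite mulrn_eq0 /= => /eqP; apply: etrans; rewrite -sum_enum_val.
  by apply: eq_bigr => i _; congr (_ * _); [rewrite !mxE | rewrite /g enum_valK].
exists (v 0) => s; have /rowP/(_ (enum_rank s)) := vE.
by rewrite mul_logmx mxE enum_rankK.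
Qed.

End LogarithmicSpan.

(** * Relative units *)

Section RelativeUnits.
Variables (R : realType) (L : splittingFieldType rat) (K : {subfield L}).
Variable iota : {rmorphism L -> algC}.
Hypothesis galK : galois 1%AS K.
Local Notation gT := (gal_of (fullv : {vspace L})).
Local Notation lg := (lg R iota).
Local Notation logmx := (logmx R iota).
Local Notation H := 'Gal({:L} / K)%g.
Local Notation norm := (galNorm K {:L}).
Implicit Types (x y : L) (s t : gT).

Lemma galois_over_full : galois K {:L}.
Proof. by apply: galoisS (galois_full L); rewrite sub1v subvf. Qed.

Lemma Gal_normal : (H <| [set: gT])%g.
Proof.
rewrite -Gal_full; have [_ _ nK] := and3P galK.
by apply: normalField_normal nK; rewrite sub1v subvf.
Qed.

Lemma card_Gal_full : #|H| = \dim_K {:L}.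
Proof. by rewrite galois_dim // galois_over_full. Qed.

Lemma galNorm_id x : x \in K -> norm x = x ^+ #|H|.
Proof.
move=> xK; rewrite /galNorm -prodr_const; apply: eq_bigr => h hH.
exact: fixed_gal (subvf K) hH xK.
Qed.

Lemma galNormXz x (m : int) : norm (x ^ m) = norm x ^ m.
Proof. by case: m => n; rewrite ?NegzE -?exprnN ?galNormV galNormX. Qed.

Lemma is_unit_int_galNorm x : is_unit_int x -> unit_of K (norm x).
Proof.
move=> xu; split; first exact: mem_galNorm galois_over_full (memvf x).
by apply: is_unit_int_prod => h _; exact: is_unit_int_gal.
Qed.

Lemma lg_galNorm x s : x != 0 -> lg (norm x) s = \sum_(h in H) lg x (h * s)%g.
Proof.
move=> x0; rewrite lg_prod => [|h _]; last by rewrite fmorph_eq0.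
by apply: eq_bigr => h _; rewrite lg_gal.
Qed.

(** The norm raises elements of [K] to the power [#|H|]; with this exponent the quotient has
    relative norm 1. *)
Definition zeta x := x ^+ #|H| / norm x.

Lemma zeta_unit x : is_unit_int x -> is_unit_int (zeta x).
Proof.
move=> xu; apply: is_unit_intM; first exact: is_unit_intX.
by apply: is_unit_intV; have [] := is_unit_int_galNorm xu.
Qed.

Lemma galNorm_zeta x : x != 0 -> norm (zeta x) = 1.
Proof.
move=> x0; have NxK : norm x \in K := mem_galNorm galois_over_full (memvf x).
by rewrite galNormM galNormX galNormV (galNorm_id NxK) divff // expf_neq0 // galNorm_eq0.
Qed.

Lemma lg_zeta x s : x != 0 ->
  lg (zeta x) s = #|H|%:R * lg x s - \sum_(h in H) lg x (h * s)%g.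
Proof.
move=> x0; have nx0 : norm x != 0 by rewrite galNorm_eq0.
by rewrite lgM ?invr_eq0 ?expf_neq0 // lgV // exprnP lgXz // lg_galNorm.
Qed.

(** The term [h = 1] of the norm cancels one of the [#|H|] copies of [lg x], whence the factor
    [#|H| - 1]. *)
Lemma sum_norm_lg_zeta x : x != 0 ->
  \sum_s `|lg (zeta x) s| <= 2 * (#|H| - 1)%:R * \sum_s `|lg x s|.
Proof.
move=> x0; have card_H1 : #|[pred h in H | h != 1%g]| = (#|H| - 1)%N.
  rewrite (cardD1 1%g H) group1 addKn; apply: eq_card => h.
  by rewrite !inE andbC.
apply: (@le_trans _ _ (\sum_s ((#|H| - 1)%:R * `|lg x s| +
    \sum_(h in H | h != 1%g) `|lg x (h * s)%g|))).
  apply: ler_sum => s _; rewrite lg_zeta // (bigD1 1%g) ?group1 //= mul1g opprD addrA.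
  have -> : #|H|%:R * lg x s - lg x s = (#|H| - 1)%:R * lg x s.
    by rewrite natrB ?cardG_gt0 // mulrBl mul1r.
  apply: le_trans (ler_normB _ _) _; rewrite normrM normr_nat lerD2l.
  exact: ler_norm_sum.
rewrite big_split /= -mulr_sumr exchange_big /=.
rewrite [X in _ + X](eq_bigr (fun _ => \sum_s `|lg x s|)) => [|h _].
  by rewrite sumr_const card_H1 -mulr_natl; lra.
by rewrite [RHS](reindex_inj (mulgI h)).
Qed.

Lemma max1_ge1 (y : algC) : 1 <= Num.max 1 y.
Proof. by rewrite /Order.max; case: ifP => // /ltW. Qed.

(** Logarithms of a unit sum to 0, so adding them to their absolute values keeps the total and
    leaves twice the positive parts. *)
Lemma log2_Hd x : is_unit_int x -> \sum_s `|lg x s| = 2 * log2 R (Hd iota x).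
Proof.
move=> xu; have pos s : 0 < `|iota (s x)| by rewrite norm_gal_gt0 ?is_unit_neq0.
have -> : Hd iota x = \prod_(s : gT) Num.max 1 `|iota (s x)|.
  by apply: eq_bigl => s; rewrite gal_full.
rewrite log2_prod => [|s _]; last exact: lt_le_trans ltr01 (max1_ge1 _).
transitivity (\sum_s `|lg x s| + \sum_s lg x s); first by rewrite sum_lg_unit ?addr0.
rewrite mulr_sumr -big_split /=.
apply: eq_bigr => s _; rewrite log2_max1 // -/(lg x s).
by case: (lerP 0 (lg x s)) => h; [rewrite ger0_norm // | rewrite ltr0_norm //]; lra.
Qed.

Lemma Hd_ge1 x : 1 <= Hd iota x.
Proof.
rewrite /Hd; elim/big_ind: _ => // [y z y1 z1|s _]; last exact: max1_ge1.
by rewrite mulr_ege1.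
Qed.

Variables (rl rk : nat) (eta : 'I_rl -> L).
Hypotheses (rank_K : unit_rank K rk) (rk_le : (rk <= rl)%N) (eta_basis : is_basis_F eta).

Let eta_unit j : is_unit_int (eta j). Proof. by case: eta_basis. Qed.
Let eta0 j : eta j != 0. Proof. exact: is_unit_neq0. Qed.
Let z j := zeta (eta j).
Let z_unit j : is_unit_int (z j). Proof. exact: zeta_unit. Qed.

(** [#|H|] times the logarithms of the basis, of rank [rl], is the sum of those of the norms and of
    the [z j]; the norms are units of [K] and contribute rank at most [rk]. *)
Lemma rank_zeta : (rl - rk <= \rank (logmx z))%N.
Proof.
have /eqP rank_eta : row_free (logmx eta).
  by apply: mult_indep_row_free => //; case: eta_basis => _ [].
have rank_norm : (\rank (logmx (norm \o eta)) <= rk)%N.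
  rewrite leqNgt; apply/negP => rk_lt; case: rank_K => _; apply.
  have [|f f_indep] := rank_mult_indep _ rk_lt.
    by move=> j; have [] := is_unit_int_galNorm (eta_unit j).
  by exists (norm \o eta \o f); split=> // i; exact: is_unit_int_galNorm.
rewrite leq_subLR -[X in (X <= _)%N]rank_eta -(mxrank_scale_nz (a := #|H|%:R)); last first.
  by rewrite pnatr_eq0 -lt0n cardG_gt0.
have -> : #|H|%:R *: logmx eta = logmx (norm \o eta) + logmx z.
  apply/matrixP => j i; rewrite !mxE lg_zeta // lg_galNorm // addrC subrK //.
by apply: leq_trans (mxrank_add _ _) _; rewrite leq_add2r.
Qed.

(** The logarithm of [x] is an integer combination of left translates of that of [g], and normality
    of [H] preserves zero coset sums under translation. *)
Lemma conj_subgroup_lg g x : is_unit_int g -> norm g = 1 -> conj_subgroup g x ->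
  is_unit_int x /\ forall s, \sum_(h in H) lg x (h * s)%g = 0.
Proof.
move=> gu norm_g [e xe].
pose y := \prod_(t in 'Gal({:L} / 1%AS)%g) (t g) ^ e t.
have tg_unit t : is_unit_int (t g) by exact: is_unit_int_gal.
have yu : is_unit_int y by apply: is_unit_int_prod => t _; exact: is_unit_intXz.
have y0 := is_unit_neq0 yu.
have xE : x = x / y * y by rewrite divfK.
have xu : is_unit_int x by rewrite xE; apply: is_unit_intM yu; exact: root_of_unity_is_unit.
split=> // s; have lg_x t : lg x t = \sum_u (e u)%:~R * lg g (u * t)%g.
  rewrite xE lgM ?(is_unit_neq0 (root_of_unity_is_unit xe)) //.
  rewrite lg_root_of_unity // add0r lg_prod => [|u _]; last first.
    by rewrite expfz_neq0 ?is_unit_neq0.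
  by apply: eq_big => [u|u _]; rewrite ?gal_full // lgXz ?is_unit_neq0 // lg_gal.
under eq_bigr => h _ do rewrite lg_x.
rewrite exchange_big big1 //= => t _; rewrite -mulr_sumr.
under eq_bigr => h _ do rewrite mulgA.
rewrite (sum_lcoset_rcoset Gal_normal (fun u => lg g (u * s)%g)).
under eq_bigr => h _ do rewrite -mulgA.
by rewrite -lg_galNorm ?is_unit_neq0 // norm_g lg1 mulr0.
Qed.

(** Logarithms of units of [K] are constant on cosets of [H], those from [conj_subgroup g] have zero
    coset sums, so the two spans meet in 0. Added to [rk] independent units of [K], the [u i] would
    have rank [rl + 1] in a span of [rl] logarithms. *)
Lemma conj_subgroup_rank_le g : is_unit_int g -> norm g = 1 ->
  ~ exists u : 'I_(rl - rk).+1 -> L, (forall i, conj_subgroup g (u i)) /\ mult_indep u.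
Proof.
move=> gu norm_g [u [ug u_indep]].
have uu i : is_unit_int (u i) by have [] := conj_subgroup_lg gu norm_g (ug i).
have [[v [vK v_indep]] _] := rank_K.
have vu i : is_unit_int (v i) by have [] := vK i.
have /eqP rank_u : row_free (logmx u) by exact: mult_indep_row_free.
have /eqP rank_v : row_free (logmx v) by exact: mult_indep_row_free.
have cap0 : (logmx u :&: logmx v)%MS = 0.
  apply/eqP/rowV0P => w; rewrite sub_capmx => /andP[/submxP[a wa] /submxP[b wb]].
  apply/rowP => i; rewrite mxE.
  have wE s : w 0 (enum_rank s) = \sum_k a 0 k * lg (u k) s.
    by rewrite wa mul_logmx enum_rankK.
  have wE' s : w 0 (enum_rank s) = \sum_k b 0 k * lg (v k) s.
    by rewrite wb mul_logmx enum_rankK.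
  have w_sum0 s : \sum_(h in H) w 0 (enum_rank (h * s)%g) = 0.
    under eq_bigr => h _ do rewrite wE.
    rewrite exchange_big big1 //= => k _; rewrite -mulr_sumr.
    by have [_ ->] := conj_subgroup_lg gu norm_g (ug k); rewrite mulr0.
  have : \sum_(h in H) w 0 (enum_rank (h * enum_val i)%g) = #|H|%:R * w 0 i.
    rewrite -{2}(enum_valK i) wE' mulr_sumr; under eq_bigr => h _ do rewrite wE'.
    rewrite exchange_big; apply: eq_bigr => k _; have [vkK _] := vK k.
    rewrite -mulr_sumr -lg_galNorm ?is_unit_neq0 // galNorm_id // exprnP.
    by rewrite lgXz ?is_unit_neq0 // mulrCA.
  rewrite w_sum0 => /esym/eqP; rewrite mulf_eq0 pnatr_eq0.
  by rewrite -[_ == 0%N]negbK -lt0n cardG_gt0 => /eqP.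
have := mxrank_sum_cap (logmx u) (logmx v).
rewrite cap0 mxrank0 rank_u rank_v addn0 => rank_sum.
have : (\rank (logmx u + logmx v)%MS <= rl)%N.
  apply: leq_trans (rank_leq_row (logmx eta)); apply: mxrankS.
  by rewrite addsmx_sub !(logmx_sub_basis _ _ eta_basis).
by rewrite rank_sum addSn subnK // ltnn.
Qed.

Lemma exists_relative_minkowski_unit :
  exists2 g, rel_minkowski K (rl - rk) g &
    Hd iota g <= \prod_j Hd iota (eta j) ^+ (4 * (\dim_K {:L} - 1)).
Proof.
have [c [cc cE]] := conj_gal iota.
have [m [m_le m_inj]] := exists_relative_minkowski_vector
  (a := fun j => lg (eta j)) (z := fun j => lg (z j)) Gal_normal cc
  (fun j s => lg_conj R _ s cE) (fun j s => lg_zeta s (eta0 j))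
  (fun f => log_units_span eta_basis cc cE).
pose g := \prod_j z j ^ m j.
have gu : is_unit_int g by apply: is_unit_int_prod => j _; exact: is_unit_intXz.
have norm_g : norm g = 1.
  by rewrite galNorm_prod big1 // => j _; rewrite galNormXz galNorm_zeta // exp1rz.
have lg_g s : lg g s = \sum_j (m j)%:~R * lg (z j) s.
  rewrite lg_prod => [|j _]; last by rewrite expfz_neq0 ?is_unit_neq0.
  by apply: eq_bigr => j _; rewrite lgXz ?is_unit_neq0.
exists g.
  split; first by split=> //; exists 1%N; rewrite // norm_g expr1.
  split; last exact: conj_subgroup_rank_le.
  (* With the inverse here, multiplying a row by [logmx T] is convolution with the logarithm of
     [g]. *)
  pose T (i : 'I_#|{: gT}|) := ((enum_val i)^-1)%g g.
  have rank_T : (\rank (logmx z) <= \rank (logmx T))%N.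
    rewrite -(mxrank_mul_ker (logmx z) (logmx T)).
    (* [m_inj] is the injectivity of this convolution on the row space of [logmx z]. *)
    have -> : (logmx z :&: kermx (logmx T))%MS = 0.
      apply/eqP/rowV0P => w; rewrite sub_capmx => /andP[/submxP[b wb] /sub_kermxP wT].
      have wE s : w 0 (enum_rank s) = \sum_j b 0 j * lg (z j) s.
        by rewrite wb mul_logmx enum_rankK.
      apply/rowP => i; rewrite mxE -(enum_valK i) wE; apply: m_inj => s.
      have /rowP/(_ (enum_rank s)) := wT.
      rewrite mul_logmx [X in _ = X]mxE enum_rankK; apply: etrans.
      rewrite -sum_enum_val; apply: eq_bigr => k _.
      by rewrite -wE enum_valK -lg_g lg_gal.
    by rewrite mxrank0 addn0 mxrankM_maxr.
  have T_unit i : is_unit_int (T i) by exact: is_unit_int_gal.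
  have [f f_indep] := rank_mult_indep T_unit (leq_trans rank_zeta rank_T).
  exists (T \o f); split=> // i; pose t := ((enum_val (f i))^-1)%g.
  exists (fun s => (s == t)%:R); exists 1%N => //; rewrite expr1.
  rewrite (bigD1 t) ?gal_full //= eqxx big1 => [|s /andP[_ /negPf->]]; last by rewrite expr0z.
  by rewrite mulr1 expr1z divff // is_unit_neq0.
have Hd0 x : 0 < Hd iota x by apply: lt_le_trans (Hd_ge1 x).
have Hd_gt0 k j : 0 < Hd iota (eta j) ^+ k by rewrite exprn_gt0.
rewrite -(log2_mono R) ?posrE //; last by apply: prodr_gt0 => j _.
(* In l^1 norms, which are twice [log2] of [Hd], the factor 2 of [m_le] and the factor
   [2 * (#|H| - 1)] for each [z j] multiply to the exponent. *)
rewrite -(ler_pM2l (ltr0n _ 2)) -log2_Hd // log2_prod // mulr_sumr.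
under eq_bigr => s _ do rewrite lg_g.
apply: le_trans m_le _; rewrite mulr_sumr; apply: ler_sum => j _.
rewrite ler_pM2l ?ltr0n //; apply: le_trans (sum_norm_lg_zeta (eta0 j)) _.
rewrite exprnP log2Xz // log2_Hd // -card_Gal_full -pmulrn natrM.
by rewrite mulrCA !mulrA; lra.
Qed.

End RelativeUnits.

(* h(gamma) <= c * sum_j h(eta_j)  <=>  Hd gamma <= prod_j (Hd eta_j)^c,
   with c = 4([l:k]-1) in case (i) and 8([l:k]-1) in case (ii). *)
Theorem theorem1p2 (L : splittingFieldType rat) (K : {subfield L})
    (iota : {rmorphism L -> algC}) (rl rk : nat)
    (hK : galois 1%AS K)
    (hrl : unit_rank (fullv : {subfield L}) rl) (hrk : unit_rank K rk)
    (hrk1 : (1 <= rk)%N) (hrkl : (rk < rl)%N)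
    (eta : 'I_rl -> L) (heta : is_basis_F eta) :
  (totally_real iota ->
     exists2 g : L, rel_minkowski K (rl - rk) g &
       Hd iota g <= \prod_(j < rl) Hd iota (eta j) ^+ (4 * (\dim_K (fullv : {vspace L}) - 1))) /\
  (totally_complex iota ->
     exists2 g : L, rel_minkowski K (rl - rk) g &
       Hd iota g <= \prod_(j < rl) Hd iota (eta j) ^+ (8 * (\dim_K (fullv : {vspace L}) - 1))).
Proof.
have [g g_mink g_le] := exists_relative_minkowski_unit
  Rdefinitions.R iota hK hrk (ltnW hrkl) heta.
(* Each [Hd iota (eta j)] is at least 1, so the bound with 4 implies the one with 8. *)
split=> _; exists g => //; apply: le_trans g_le _.
apply: ler_prod => j _; have Hd1 := Hd_ge1 iota (eta j).
rewrite exprn_ge0 ?(le_trans ler01) //=.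
by rewrite ler_weXn2l // leq_mul2r orbT.
Qed.
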